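(* Let $P\subset\mathbb{R}^m$ be a Delzant lattice polytope with vertices in $\mathbb{Z}^m$ (with non-empty interior), let $S=P\cap\mathbb{Z}^m$, $c:S\to\mathbb{R}_{>0}$, let $N$ be a positive integer and $S_N=NP\cap\mathbb{Z}^m$. Let $$d\nu_N^x=\frac{1}{\Pi_N(x)}\sum_{\gamma\in S_N}\frac{m_{S,N}^\gamma(x)}{R_N(\gamma)}\,\delta_{\gamma/N},\qquad x\in P,$$ be the Bergman-Bernstein measure, and let $d\mathcal{B}_x^N$ be the dilated $N$-fold convolution power of the finitely supported Bernstein measure $\mathcal{B}_{S,c}(x)=\sum_{\alpha\in S}m_{S,c,\alpha}(x)\delta_\alpha$. Then the following four conditions are equivalent: (1) $R_N(\gamma)$ is constant as a function of $\gamma$ on the finite set $S_N$; (2) the function $\Pi_N(x)$ is constant; (3) the barycenter of $d\nu_N^x$ is $x$ for each $x\in P$; (4) $d\nu_N^x=d\mathcal{B}_x^N$ for each $x\in P$.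
   Context: A lattice polytope $P$ of dimension $m$ is Delzant if each vertex lies on exactly $m$ edges and the $m$ lattice vectors incident from the vertex along these edges form a $\mathbb{Z}$-basis of $\mathbb{Z}^m$. $P^o$ denotes the interior of $P$, and $\delta_y$ the Dirac measure at $y$. The map $\mu_{S,c}(\tau)=\sum_{\alpha\in S}\frac{c(\alpha)e^{\langle\alpha,\tau\rangle}}{\sum_{\beta\in S}c(\beta)e^{\langle\beta,\tau\rangle}}\alpha$ is a diffeomorphism $\mathbb{R}^m\to P^o$ with inverse $\tau_{S,c}$. For $\alpha\in S$, $m_{S,c,\alpha}$ is the continuous function on $P$ given on $P^o$ by $m_{S,c,\alpha}(x)=\frac{c(\alpha)e^{\langle\alpha,\tau_{S,c}(x)\rangle}}{\sum_{\beta\in S}c(\beta)e^{\langle\beta,\tau_{S,c}(x)\rangle}}$ (it extends continuously to $P$). For $\gamma\in S_N$, $$m_{S,N}^\gamma(x)=\sum_{\beta_1,\ldots,\beta_N\in S,\ \beta_1+\cdots+\beta_N=\gamma}m_{S,c,\beta_1}(x)\cdots m_{S,c,\beta_N}(x),$$ $$R_N(\gamma)=\int_P m_{S,N}^\gamma(x)\,dx,\qquad \Pi_N(x)=\sum_{\gamma\in S_N}\frac{m_{S,N}^\gamma(x)}{R_N(\gamma)},\quad x\in P.$$ The dilated convolution power is $d\mathcal{B}_x^N=(D_{1/N})_*(\mathcal{B}_{S,c}(x)*\cdots*\mathcal{B}_{S,c}(x))$ ($N$ factors), $D_{1/N}(y)=y/N$; it equals $\sum_{\gamma\in S_N}m_{S,N}^\gamma(x)\delta_{\gamma/N}$.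 The barycenter of a probability measure $\mu$ is $\int z\,d\mu(z)$. *)

(* Defs.v *)
From HB Require Import structures.
From mathcomp Require Import all_boot all_order all_algebra.
From mathcomp Require Import all_classical all_reals all_analysis.
Import Order.TTheory GRing.Theory Num.Theory.
Import numFieldNormedType.Exports.

Set Implicit Arguments.
Unset Strict Implicit.
Unset Printing Implicit Defensive.

Local Open Scope classical_set_scope.
Local Open Scope ring_scope.

(* The Borel sigma-algebra of R^n, presented as the product sigma-algebra
   (generated by the coordinates), as the library does for n.-tuple T. *)
Definition rV_display : measure_display.
Proof. exact: default_measure_display. Qed.

Section measurable_rV.
Variables (R : realType) (n : nat).

Let coords : 'I_n -> 'rV[R]_n -> measurableTypeR R := fun i x => x ord0 i.

Let rV_set0 : g_sigma_preimage coords set0.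
Proof. exact: sigma_algebra0. Qed.

Let rV_setC A : g_sigma_preimage coords A -> g_sigma_preimage coords (~` A).
Proof. exact: sigma_algebraC. Qed.

Let rV_bigcup (F : (set 'rV[R]_n)^nat) :
  (forall i, g_sigma_preimage coords (F i)) ->
  g_sigma_preimage coords (\bigcup_i (F i)).
Proof. exact: sigma_algebra_bigcup. Qed.

HB.instance Definition _ := @isMeasurable.Build rV_display
  'rV[R]_n (g_sigma_preimage coords) rV_set0 rV_setC rV_bigcup.

End measurable_rV.

Section lebesgue.
Variable R : realType.

Fixpoint lebesgue_rV (n : nat) : set 'rV[R]_n -> \bar R :=
  match n return set 'rV[R]_n -> \bar R with
  | 0 => \d_(0 : 'rV[R]_0)
  | k.+1 => pushforward (lebesgue_measure \x @lebesgue_rV k)%E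
      (fun p : measurableTypeR R * 'rV[R]_k =>
         (row_mx (p.1)%:M p.2 : 'rV[R]_(k.+1)))
  end.

End lebesgue.

Section measures_on_rV.
Variables (R : realType) (m : nat).
Implicit Types mu nu : set 'rV[R]_m -> \bar R.

Definition discrete_measure (A : set 'rV[R]_m) (a : 'rV[R]_m -> R)
    (p : 'rV[R]_m -> 'rV[R]_m) : set 'rV[R]_m -> \bar R :=
  fun X => (\sum_(g \in A) (a g)%:E * \d_(p g) X)%E.

Definition convolution mu nu : set 'rV[R]_m -> \bar R :=
  pushforward (mu \x nu)%E (fun p : 'rV[R]_m * 'rV[R]_m => p.1 + p.2).

(* mu * ... * mu with N factors, for N > 0. *)
Definition convolution_power (N : nat) mu : set 'rV[R]_m -> \bar R :=
  iter N.-1 (convolution mu) mu.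

Definition dilation (N : nat) (y : 'rV[R]_m) : 'rV[R]_m := N%:R^-1 *: y.

Definition barycenter mu : 'rV[R]_m :=
  \row_j fine (\int[mu]_z (z ord0 j)%:E)%E.

End measures_on_rV.

Section polytopes.
Variables (R : realType) (m : nat).
Implicit Types (P F V : set 'rV[R]_m) (u v x y : 'rV[R]_m).

Definition dotp x y : R := \sum_i x ord0 i * y ord0 i.

Definition lattice : set 'rV[R]_m := [set x | forall i, x ord0 i \is a Num.int].

Definition convex_hull V : set 'rV[R]_m :=
  [set x | exists (k : nat) (v : 'I_k -> 'rV[R]_m) (a : 'I_k -> R),
    [/\ forall i, V (v i), forall i, 0 <= a i, \sum_i a i = 1
      & x = \sum_i a i *: v i]].

Definition lattice_polytope P :=
  exists V, [/\ finite_set V, V `<=` lattice & P = convex_hull V].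

Definition segment x y : set 'rV[R]_m :=
  [set (1 - t) *: x + t *: y | t in `[0, 1]].

(* F is cut out by a valid inequality; u = 0 gives the improper faces. *)
Definition face P F :=
  exists u (b : R), (forall x, P x -> dotp u x <= b) /\
    F = P `&` [set x | dotp u x = b].

Definition vertex P v := face P [set v].

Definition edge P F := face P F /\ exists x y, x != y /\ F = segment x y.

Definition primitive u :=
  [/\ lattice u, u != 0 & forall t, 0 < t < 1 -> ~ lattice (t *: u)].

(* u is the primitive lattice vector pointing from v along the edge F. *)
Definition incident_vector v F u :=
  primitive u /\ exists2 t, 0 < t & F = segment v (v + t *: u).

Definition lattice_basis (e : 'I_m -> 'rV[R]_m) :=
  (forall i, lattice (e i)) /\
  forall z, lattice z ->
    exists! k : 'rV[int]_m, z = \sum_i (k ord0 i)%:~R *: e i.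

Definition Delzant P :=
  forall v, vertex P v ->
    exists (F : 'I_m -> set 'rV[R]_m) (e : 'I_m -> 'rV[R]_m),
      [/\ injective F, range F = [set E | edge P E /\ E v],
          forall i, incident_vector v (F i) (e i) & lattice_basis e].

End polytopes.
Arguments lattice {R m}.

Section bernstein.
Variables (R : realType) (m : nat).
Variable P : set 'rV[R]_m.
Variable c : 'rV[R]_m -> R.

Definition lattice_points : set 'rV[R]_m := P `&` lattice.

Definition dilated_lattice_points (N : nat) : set 'rV[R]_m :=
  [set N%:R *: x | x in P] `&` lattice.

Definition gibbs_weight (alpha t : 'rV[R]_m) : R :=
  c alpha * expR (dotp alpha t) /
    \sum_(beta \in lattice_points) c beta * expR (dotp beta t).

Definition moment_map (t : 'rV[R]_m) : 'rV[R]_m :=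
  \sum_(alpha \in lattice_points) gibbs_weight alpha t *: alpha.

Definition inverse_moment_map (x : 'rV[R]_m) : 'rV[R]_m :=
  xget 0 [set t | moment_map t = x].

(* w alpha is m_{S,c,alpha}: the continuous function on P (unique on P, the
   interior being dense) extending the given one on the interior. *)
Definition bernstein_weights (w : 'rV[R]_m -> 'rV[R]_m -> R) :=
  forall alpha, lattice_points alpha ->
    {within P, continuous (w alpha)} /\
    forall x, P° x -> w alpha x = gibbs_weight alpha (inverse_moment_map x).

Variable w : 'rV[R]_m -> 'rV[R]_m -> R.

Definition bernstein_measure (x : 'rV[R]_m) : set 'rV[R]_m -> \bar R :=
  discrete_measure lattice_points (w^~ x) id.

Variable N : nat.

Definition weight_power (gamma x : 'rV[R]_m) : R :=
  \sum_(beta \in [set beta : {ffun 'I_N -> 'rV[R]_m} |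
      (forall i, lattice_points (beta i)) /\ \sum_i beta i = gamma])
    \prod_i w (beta i) x.

Definition RN (gamma : 'rV[R]_m) : R :=
  fine (\int[@lebesgue_rV R m]_(x in P) (weight_power gamma x)%:E)%E.

Definition PiN (x : 'rV[R]_m) : R :=
  \sum_(gamma \in dilated_lattice_points N) weight_power gamma x / RN gamma.

(* Every denominator R_N(gamma) is non-zero. This is what Pi_N and nu_N^x need
   in order to be defined (then Pi_N > 0 on P). It fails exactly when some
   point of S_N is not a sum of N points of S; whether that can happen for a
   Delzant polytope is open (Oda's conjecture). *)
Definition bergman_defined :=
  forall gamma, dilated_lattice_points N gamma -> RN gamma != 0.

Definition bergman_bernstein_measure (x : 'rV[R]_m) : set 'rV[R]_m -> \bar R :=
  discrete_measure (dilated_lattice_points N)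
    (fun gamma => (PiN x)^-1 * (weight_power gamma x / RN gamma)) (dilation N).

Definition dilated_bernstein_measure (x : 'rV[R]_m) : set 'rV[R]_m -> \bar R :=
  pushforward (convolution_power N (bernstein_measure x)) (dilation N).

End bernstein.

(* Main.v *)
(** On the interior write x as the Gibbs mean of the points of S at a unique
    t. Then m^gamma(x) = c_gamma e^<gamma,t> / Z(t)^N, where c_gamma is the
    coefficient of e^<gamma,t> in Z(t)^N. Since the m^gamma sum to 1 and have
    mean N x, a constant R_N gives a constant Pi_N, barycenter x and
    nu_N^x = B_x^N. Conversely put F(t) = sum_gamma c_gamma / R_N(gamma)
    e^<gamma,t>, so that Pi_N = F / Z^N. If the barycenter of nu_N^x is x, then
    grad log F = N grad log Z, so Pi_N is constant; and if Pi_N is constant,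
    comparing F with Z^N term by term (exponentials are linearly independent)
    shows that R_N is constant. If the measures agree, comparing their atoms at
    one interior point already gives R_N = 1 / Pi_N. *)

Require Import Defs.
From HB Require Import structures.
From mathcomp Require Import all_boot all_order all_algebra finmap.
From mathcomp Require Import all_classical all_reals all_analysis.
From mathcomp Require Import measurable_realfun ring lra.
Import Order.TTheory GRing.Theory Num.Theory.
Import numFieldNormedType.Exports.

Set Implicit Arguments.
Unset Strict Implicit.
Unset Printing Implicit Defensive.

Local Open Scope classical_set_scope.
Local Open Scope ring_scope.

(** The weights have a formula on the interior only. Nonnegativity, total mass 1 and mean x are
    proved there and carried to P by density; the converse implications evaluate at interior points
    alone. For x in the interior, t is obtained by minimising sum_j c_j e^<al_j - x, t>, which is
    coercive because a whole box around x lies in the hull; uniqueness comes from the monotonicity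
    of exp. The other obstacle is the division by R_N(gamma), a total operation with 1/0 = 0.
    Constancy of R_N has to imply [bergman_defined], so a zero constant must be excluded: one
    R_N(gamma) is bounded below by an actual estimate of a Lebesgue integral. Conversely R_N(gamma)
    != 0 forces c_gamma > 0, which is what allows the coefficients to be cancelled. No gradient is
    formed: every derivative is taken along a line in the variable t. *)

(** * Finitely supported measures and their integrals *)

Section finite_atomic.
Context d (T : measurableType d) (R : realType).
Local Open Scope ereal_scope.

(** The measures of the theorem are bare set functions, whereas integration lemmas want a bundled
    measure. The induction builds the bundle together with its integral formula, adding one scaled
    Dirac mass at a time. *)
Lemma atomic_measureP (I : Type) (s : seq I) (a : I -> R) (p : I -> T) :
  (forall i, 0 <= a i)%R ->
  exists2 mu : {measure set T -> \bar R},
    mu = (fun X => \sum_(i <- s) (a i)%:E * \d_(p i) X) :> (set T -> \bar R) &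
    forall f : T -> \bar R, measurable_fun setT f -> (forall x, 0 <= f x) ->
      \int[mu]_x f x = \sum_(i <- s) (a i)%:E * f (p i).
Proof.
move=> a0; elim: s => [|i s [mu muE imu]].
  exists (@mzero _ T R) => [|f mf f0].
    by apply/funext => X; rewrite big_nil.
  by rewrite big_nil integral_measure_zero.
exists (measure_add (mscale (NngNum (a0 i)) (\d_(p i))) mu) => [|f mf f0].
  by apply/funext => X; rewrite [LHS]measure_addE big_cons muE.
rewrite ge0_integral_measure_add// big_cons imu// ge0_integral_mscale//=.
by rewrite integral_dirac// diracT mul1e.
Qed.

Lemma ge0_integral_atomic (I : Type) (s : seq I) (a : I -> R) (p : I -> T)
    (f : T -> \bar R) :
  (forall i, 0 <= a i)%R -> measurable_fun setT f -> (forall x, 0 <= f x) ->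
  \int[fun X => \sum_(i <- s) (a i)%:E * \d_(p i) X]_x f x =
    \sum_(i <- s) (a i)%:E * f (p i).
Proof.
by move=> a0 mf f0; have [mu <- ->] := atomic_measureP s p a0.
Qed.

Lemma integral_atomic (I : Type) (s : seq I) (a : I -> R) (p : I -> T)
    (f : T -> R) :
  (forall i, 0 <= a i)%R -> measurable_fun setT f ->
  \int[fun X => \sum_(i <- s) (a i)%:E * \d_(p i) X]_x (f x)%:E =
    (\sum_(i <- s) a i * f (p i))%:E.
Proof.
move=> a0 mf; have [mu <- imu] := atomic_measureP s p a0.
have mfE : measurable_fun setT (EFin \o f) by exact/measurable_EFinP.
rewrite integralE !imu//; [|exact: measurable_funeneg|exact: measurable_funepos].
have E (g : T -> R) : \sum_(i <- s) (a i)%:E * (g (p i))%:E =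
    (\sum_(i <- s) a i * g (p i))%:E.
  by rewrite -sumEFin; apply: eq_bigr => i _; rewrite EFinM.
rewrite [X in X - _](_ : _ =
    (\sum_(i <- s) a i * Num.max (f (p i)) 0)%:E); last first.
  by rewrite -(E (fun x => Num.max (f x) 0%R)); apply: eq_bigr => i _;
    rewrite funeposE -EFin_max.
rewrite [X in _ - X](_ : _ =
    (\sum_(i <- s) a i * Num.max (- f (p i)) 0)%:E); last first.
  by rewrite -(E (fun x => Num.max (- f x) 0%R)%R); apply: eq_bigr => i _;
    rewrite funenegE -EFin_max.
rewrite -EFinB -sumrB; congr _%:E; apply: eq_bigr => i _.
rewrite -mulrBr; congr (_ * _)%R.
by case: (lerP 0%R (f (p i))) => h; rewrite /Num.max; do !case: ifPn => ?; lra.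
Qed.

End finite_atomic.

(** * Measurability in the space of row vectors *)

Section rV_measurability.
Variables (R : realType) (m : nat).

Lemma measurable_coord (i : 'I_m) :
  measurable_fun [set: 'rV[R]_m] (fun x => x ord0 i).
Proof.
move=> _ Y mY; rewrite setTI; apply: sub_sigma_algebra => /=.
rewrite -bigcup_seq/=; exists i => /=; first by rewrite mem_index_enum.
by exists Y => //; rewrite setTI.
Qed.

Lemma measurable_fun_rV d (T : measurableType d) (f : T -> 'rV[R]_m) :
  (forall i, measurable_fun setT (fun t => f t ord0 i)) ->
  measurable_fun setT f.
Proof.
move=> mf.
have H : g_sigma_preimage (fun i (t : T) => f t ord0 i : measurableTypeR R)
    `<=` measurable.
  apply: smallest_sub; first exact: sigma_algebra_measurable.
  rewrite -bigcup_seq; apply: bigcup_sub => i _ A [B mB <-]; exact: mf.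
move=> _ A mA; apply: H.
rewrite (g_sigma_preimage_comp
  (fun i (x : 'rV[R]_m) => x ord0 i : measurableTypeR R) f : _ = _).
by exists A => //; rewrite setTI.
Qed.

Lemma measurable_addl (v : 'rV[R]_m) : measurable_fun setT (fun x => v + x).
Proof.
apply: measurable_fun_rV => i.
under eq_fun do rewrite mxE.
by apply: measurable_funD => //; exact: measurable_coord.
Qed.

Lemma measurable_dilation N : measurable_fun setT (@dilation R m N).
Proof.
apply: measurable_fun_rV => i; rewrite /dilation.
under eq_fun do rewrite mxE.
by apply: measurable_funM => //; exact: measurable_coord.
Qed.

(** The closed ball of the sup norm, written by coordinates so that it is a product of intervals, of
    known volume and plainly measurable. *)
Definition box (x : 'rV[R]_m) (r : R) : set 'rV[R]_m :=
  [set y | forall i, `|y ord0 i - x ord0 i| <= r].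

Lemma measurable_box x r : measurable (box x r).
Proof.
rewrite (_ : box x r = \bigcap_(i in [set: 'I_m])
    ((fun y : 'rV[R]_m => y ord0 i) @^-1` `[x ord0 i - r, x ord0 i + r])).
  apply: fin_bigcap_measurable => // i _; rewrite -[X in measurable X]setTI.
  by apply: measurable_coord => //; exact: measurable_itv.
apply/seteqP; split => y /=.
  by move=> h i _ /=; rewrite in_itv/= -ler_distlC distrC h.
by move=> h i; have := h i I; rewrite /= in_itv/= -ler_distlC distrC.
Qed.

Lemma measurable_set1_rV (x : 'rV[R]_m) : measurable [set x].
Proof.
rewrite (_ : [set x] = box x 0); first exact: measurable_box.
apply/seteqP; split => y /= => [-> i|h]; first by rewrite subrr normr0.
by apply/rowP => i; apply/eqP; rewrite -subr_eq0 -normr_le0 h.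
Qed.

End rV_measurability.

(** * Lebesgue measure on row vectors *)

Section lebesgue_rV_measure.
Variable R : realType.
Local Open Scope ereal_scope.

Let join k (p : measurableTypeR R * 'rV[R]_k) : 'rV[R]_k.+1 :=
  row_mx (p.1)%:M p.2.

Let joinE0 k p : @join k p ord0 ord0 = p.1.
Proof.
rewrite /join /row_mx mxE; case: splitP => j //=; rewrite ord1 => _.
by rewrite mxE eqxx.
Qed.

Let joinES k p i : @join k p ord0 (lift ord0 i) = p.2 ord0 i.
Proof.
rewrite /join /row_mx mxE; case: splitP => j /=; first by rewrite ord1.
by rewrite /bump /= => -[] /val_inj ->.
Qed.

Let measurable_join k : measurable_fun setT (@join k).
Proof.
apply: measurable_fun_rV => i; case: (unliftP ord0 i) => [j ->|->].
  under eq_fun do rewrite joinES.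
  exact: (measurableT_comp (@measurable_coord R k j) measurable_snd).
under eq_fun do rewrite joinE0.
exact: measurable_fst.
Qed.

(** The product with a measure is again a measure when that factor is sigma-finite, so the induction
    must carry sigma-finiteness along; the volume of boxes is what provides it at the next
    dimension. *)
Lemma lebesgue_rV_measure n :
  exists2 mu : {sigma_finite_measure set 'rV[R]_n -> \bar R},
    mu = @lebesgue_rV R n :> (set 'rV[R]_n -> \bar R) &
    forall x r, (0 <= r)%R -> mu (box x r) = ((2 * r) ^+ n)%:E.
Proof.
elim: n => [|n [mu muE mubox]].
  exists (\d_(0%R : 'rV[R]_0)) => // x r r0.
  by rewrite [LHS]diracE mem_set ?expr0// => -[].
pose push : {measure set 'rV[R]_n.+1 -> \bar R} :=
  pushforward (lebesgue_measure \x mu) (@join n).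
pose nu := push (@measurable_join n).
have nubox x r : (0 <= r)%R -> nu (box x r) = ((2 * r) ^+ n.+1)%:E.
  move=> r0; rewrite /nu /push /= /pushforward.
  rewrite (_ : _ @^-1` _ = `[x ord0 ord0 - r, x ord0 ord0 + r]%classic `*`
      box (\row_i x ord0 (lift ord0 i)) r)%R; last first.
    apply/seteqP; split => -[u v] /=.
      move=> h; split => [|i].
        by have := h ord0; rewrite joinE0 /= in_itv/= -ler_distlC distrC.
      by have := h (lift ord0 i); rewrite joinES mxE.
    move=> [+ h] i; rewrite in_itv/= -ler_distlC distrC => h0.
    case: (unliftP ord0 i) => [j ->|->]; last by rewrite joinE0.
    by have := h j; rewrite joinES mxE.
  rewrite [LHS]product_measure1E//; [|exact: measurable_box].
  rewrite mubox// exprS EFinM; congr (_ * _).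
  rewrite [LHS]lebesgue_measure_itv/= lte_fin.
  case: ifPn => [_|]; first by rewrite -EFinB; congr _%:E; ring.
  by rewrite -leNgt => h; congr _%:E; lra.
have sf : sigma_finite setT nu.
  exists (fun k => box 0%R k%:R) => [|k]; last first.
    by split; [exact: measurable_box|rewrite nubox// ltry].
  apply/seteqP; split => // x _.
  exists (Num.truncn (\sum_i `|x ord0 i|)%R).+1 => //.
  move=> i; rewrite mxE subr0.
  apply: (@le_trans _ _ (\sum_i `|x ord0 i|)%R).
    by rewrite (bigD1 i)//= lerDl sumr_ge0.
  by apply/ltW/truncnS_gt.
pose nu' : {sigma_finite_measure set 'rV[R]_n.+1 -> \bar R} :=
  HB.pack (nu : set _ -> \bar R) (Measure.on nu)
    (@Measure_isSigmaFinite.Build _ _ _ nu sf).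
exists nu' => //.
by rewrite /= muE.
Qed.

End lebesgue_rV_measure.

(** * Bounds on Lebesgue integrals *)

Section lebesgue_rV_integral.
Variables (R : realType) (m : nat).
Local Open Scope ereal_scope.
Import HBNNSimple.

Lemma fine_integral_ge0 (P : set 'rV[R]_m) (f : 'rV[R]_m -> R) :
  (forall y, P y -> 0 <= f y)%R ->
  (0 <= fine (\int[@lebesgue_rV R m]_(y in P) (f y)%:E))%R.
Proof.
move=> f0; have [mu <- _] := @lebesgue_rV_measure R m.
by apply/fine_ge0/integral_ge0 => y Py; rewrite lee_fin f0.
Qed.

(* The integral of a nonnegative function is a supremum over the simple
   functions below it, hence monotone even for non-measurable integrands. *)
Lemma fine_integral_gt0 (P : set 'rV[R]_m) (f : 'rV[R]_m -> R)
    (x x' : 'rV[R]_m) (r r' e : R) :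
  (0 < r)%R -> (0 < r')%R -> (0 < e)%R ->
  (forall y, P y -> 0 <= f y <= 1)%R -> P `<=` box x' r' ->
  box x r `<=` P -> (forall y, box x r y -> e <= f y)%R ->
  (0 < fine (\int[@lebesgue_rV R m]_(y in P) (f y)%:E))%R.
Proof.
move=> r0 r'0 e0 f01 PB BP ef; have [mu <- mubox] := @lebesgue_rV_measure R m.
have mB := @measurable_box R m.
have fP0 y : P y -> 0 <= (f y)%:E by move=> /f01/andP[? _]; rewrite lee_fin.
have ub : \int[mu]_(y in P) (f y)%:E <= mu (box x' r').
  rewrite ge0_integralE//; apply: ge_ereal_sup => _ [h hf <-].
  rewrite -[mu _]sintegral_indic.
  rewrite (_ : \1_(box x' r') = indic_nnsfun R (mB x' r'))//.
  apply: le_sintegral => y; have := hf y; rewrite /patch /= mindicE.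
  case: ifPn => [/[!inE] Py|_]; last first.
    by rewrite lee_fin => /le_trans; apply.
  have /andP[_ f1] := f01 _ Py; rewrite lee_fin => /le_trans; apply.
  by rewrite mem_set ?(le_trans f1)//; exact: PB.
have lb : e%:E * mu (box x r) <= \int[mu]_(y in P) (f y)%:E.
  rewrite ge0_integralE//; apply: ereal_sup_ubound.
  exists (scale_nnsfun (indic_nnsfun R (mB x r)) (ltW e0)); last first.
    by rewrite sintegralrM -[mu _]sintegral_indic.
  move=> y; rewrite /patch /= mindicE; case: (boolP (y \in box x r)) => [|_].
    by rewrite inE => By; rewrite mem_set ?mulr1 ?lee_fin ?ef//; exact: BP.
  by rewrite mulr0; case: ifPn => //; rewrite inE; exact: fP0.
(* [fine] sends an infinite value to 0, so the lower bound yields positivity only once the upper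
   bound has shown the integral finite. *)
rewrite -lte_fin fineK; last first.
  rewrite ge0_fin_numE; last exact: integral_ge0.
  by apply: (le_lt_trans ub); rewrite mubox ?ltry// ltW.
apply: lt_le_trans lb; rewrite mubox ?(ltW r0)// -EFinM lte_fin mulr_gt0//.
by rewrite exprn_gt0// mulr_gt0.
Qed.

End lebesgue_rV_integral.

(** * Convolution powers of atomic measures *)

Section ffun_recursion.
Variables (R : Type) (idx : R) (op : Monoid.com_law idx) (J : finType).

Definition ffun_cons n (j : J) (g : {ffun 'I_n -> J}) : {ffun 'I_n.+1 -> J} :=
  [ffun i => if unlift ord0 i is Some k then g k else j].

Lemma ffun_cons0 n j (g : {ffun 'I_n -> J}) : ffun_cons j g ord0 = j.
Proof. by rewrite ffunE unlift_none. Qed.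

Lemma ffun_consS n j (g : {ffun 'I_n -> J}) k :
  ffun_cons j g (lift ord0 k) = g k.
Proof. by rewrite ffunE liftK. Qed.

Lemma big_ffunS n (F : {ffun 'I_n.+1 -> J} -> R) :
  \big[op/idx]_f F f = \big[op/idx]_j \big[op/idx]_g F (ffun_cons j g).
Proof.
rewrite pair_big/= (reindex (fun p => ffun_cons p.1 p.2))//=.
exists (fun f => (f ord0, [ffun k => f (lift ord0 k)])).
  move=> [j g] _ /=; rewrite ffunE unlift_none; congr (_, _).
  by apply/ffunP => k; rewrite !ffunE liftK.
move=> f _; apply/ffunP => i; rewrite ffunE /=.
by case: unliftP => [k ->|->] //; rewrite ffunE.
Qed.

Lemma big_ffun0 (F : {ffun 'I_0 -> J} -> R) (g : {ffun 'I_0 -> J}) :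
  \big[op/idx]_f F f = F g.
Proof.
rewrite (big_pred1 g)// => f /=; apply/esym/eqP/ffunP; by case.
Qed.

End ffun_recursion.

Section convolution_of_atomic.
Variables (R : realType) (m : nat).
Local Open Scope ereal_scope.
Implicit Types X : set 'rV[R]_m.

(** The product measure integrates the measures of the sections, here the translates of X by -v. The
    formula for [nu] is asked on measurable sets only, because [nu] will itself be an iterated
    convolution, known only there. *)
Lemma convolution_atomic (I J : Type) (s : seq I) (t : seq J)
    (a : I -> R) (p : I -> 'rV[R]_m) (b : J -> R) (q : J -> 'rV[R]_m)
    (nu : set 'rV[R]_m -> \bar R) X :
  (forall i, 0 <= a i)%R -> (forall j, 0 <= b j)%R ->
  (forall X, measurable X -> nu X = \sum_(j <- t) (b j)%:E * \d_(q j) X) ->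
  measurable X ->
  convolution (fun X => \sum_(i <- s) (a i)%:E * \d_(p i) X) nu X =
    \sum_(i <- s) \sum_(j <- t) (a i * b j)%:E * \d_(p i + q j)%R X.
Proof.
move=> a0 b0 nuE mX; rewrite /convolution /pushforward /product_measure1.
have mpre v : measurable ((fun y => v + y)%R @^-1` X).
  by rewrite -[Y in measurable Y]setTI; exact: measurable_addl.
have E v : nu (xsection [set u : 'rV[R]_m * 'rV[R]_m | X (u.1 + u.2)%R] v) =
    (\sum_(j <- t) b j * \1_X (v + q j))%:E.
  rewrite (_ : xsection _ v = (fun y => v + y)%R @^-1` X); last first.
    by apply/seteqP; split => y; rewrite /xsection/= inE.
  rewrite nuE// -sumEFin; apply: eq_bigr => j _.
  by rewrite EFinM diracE indicE; congr (_ * (_)%:R%:E); rewrite !in_setE.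
rewrite [F in integral _ _ F](funext E).
rewrite ge0_integral_atomic//; last 2 first.
- apply/measurable_EFinP/measurable_sum => j; apply: measurable_funM => //.
  have mq : measurable_fun setT (fun v : 'rV[R]_m => v + q j)%R.
    by under eq_fun do rewrite addrC; exact: measurable_addl.
  have mi : measurable_fun setT (\1_X : 'rV[R]_m -> R) by exact: measurable_indic.
  exact: (measurableT_comp mi mq).
- by move=> v; rewrite lee_fin sumr_ge0// => j _; rewrite mulr_ge0.
apply: eq_bigr => i _; rewrite -EFinM mulr_sumr -sumEFin; apply: eq_bigr => j _.
by rewrite mulrA EFinM diracE indicE.
Qed.

Lemma convolution_power_atomic (J : finType) (a : J -> R)
    (p : J -> 'rV[R]_m) N X :
  (forall j, 0 <= a j)%R -> (0 < N)%N -> measurable X ->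
  convolution_power N (fun X => \sum_j (a j)%:E * \d_(p j) X) X =
  \sum_(f : {ffun 'I_N -> J})
    (\prod_i a (f i))%:E * \d_(\sum_i p (f i))%R X.
Proof.
move=> a0; case: N => // N _; rewrite /convolution_power /=.
(* [N] now counts convolutions, one less than the factors: the base case is a single factor. *)
elim: N X => [|N IH] X mX.
  rewrite big_ffunS /=; apply: eq_bigr => j _.
  have g : {ffun 'I_0 -> J} by apply: finfun => -[].
  rewrite (big_ffun0 _ _ g) !big_ord_recl !big_ord0 mulr1 addr0.
  by rewrite ffun_cons0.
rewrite iterS (@convolution_atomic _ _ _ (index_enum {ffun 'I_N.+1 -> J})
  _ _ (fun f => \prod_i a (f i))%R (fun f => \sum_i p (f i))%R)//; last first.
  by move=> f; apply: prodr_ge0.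
rewrite [RHS]big_ffunS; apply: eq_bigr => j _; apply: eq_bigr => g _.
have -> : (\prod_i a (ffun_cons j g i) = a j * \prod_i a (g i))%R.
  rewrite big_ord_recl ffun_cons0; congr (_ * _)%R.
  by apply: eq_bigr => i _; rewrite ffun_consS.
have -> // : (\sum_i p (ffun_cons j g i) = p j + \sum_i p (g i))%R.
rewrite big_ord_recl ffun_cons0; congr (_ + _)%R.
by apply: eq_bigr => i _; rewrite ffun_consS.
Qed.

End convolution_of_atomic.

(** * Limits of sums and products, scalar product, boxes as neighbourhoods *)

Section cvg_bigop.
Context (R : realType) (T : Type) (F : set_system T) {FF : Filter F}.
Variables (I : Type) (s : seq I) (f : I -> T -> R) (l : I -> R).
Hypothesis fl : forall i, f i x @[x --> F] --> l i.

Lemma cvg_sumr : \sum_(i <- s) f i x @[x --> F] --> \sum_(i <- s) l i.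
Proof. by apply: cvg_big => //; exact: add_continuous. Qed.

Lemma cvg_prodr : \prod_(i <- s) f i x @[x --> F] --> \prod_(i <- s) l i.
Proof. by apply: cvg_big => //; exact: mul_continuous. Qed.

End cvg_bigop.

Section dotp_theory.
Variables (R : realType) (m : nat).
Implicit Types x y z t : 'rV[R]_m.

Lemma dotpC x y : dotp x y = dotp y x.
Proof. by apply: eq_bigr => i _; rewrite mulrC. Qed.

Lemma dotpDl x y z : dotp (x + y) z = dotp x z + dotp y z.
Proof. by rewrite -big_split; apply: eq_bigr => i _; rewrite mxE mulrDl. Qed.

Lemma dotpZl a x y : dotp (a *: x) y = a * dotp x y.
Proof. by rewrite mulr_sumr; apply: eq_bigr => i _; rewrite mxE mulrA. Qed.

Lemma dotpDr x y z : dotp x (y + z) = dotp x y + dotp x z.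
Proof. by rewrite dotpC dotpDl !(dotpC x). Qed.

Lemma dotpZr a x y : dotp x (a *: y) = a * dotp x y.
Proof. by rewrite dotpC dotpZl dotpC. Qed.

Lemma dotpBl x y z : dotp (x - y) z = dotp x z - dotp y z.
Proof. by rewrite dotpDl -scaleN1r dotpZl mulN1r. Qed.

Lemma dotpBr x y z : dotp x (y - z) = dotp x y - dotp x z.
Proof. by rewrite dotpC dotpBl !(dotpC x). Qed.

Lemma dotp0l y : dotp 0 y = 0.
Proof. by rewrite -(scale0r y) dotpZl mul0r. Qed.

Lemma dotp0r x : dotp x 0 = 0.
Proof. by rewrite dotpC dotp0l. Qed.

Lemma dotp_suml (I : Type) (s : seq I) (F : I -> 'rV[R]_m) y :
  dotp (\sum_(i <- s) F i) y = \sum_(i <- s) dotp (F i) y.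
Proof.
by elim/big_rec2: _ => [|i a b _ <-]; rewrite ?dotp0l ?dotpDl.
Qed.

Lemma ler_sqr_dotp t i : t ord0 i ^+ 2 <= dotp t t.
Proof.
by rewrite /dotp (bigD1 i)//= expr2 lerDl sumr_ge0// => k _; rewrite -expr2 sqr_ge0.
Qed.

Lemma dotp_eq0 t : dotp t t <= 0 -> t = 0.
Proof.
move=> h; apply/rowP => i; rewrite mxE; apply/eqP.
by rewrite -sqrf_eq0 eq_le sqr_ge0 (le_trans (ler_sqr_dotp t i)).
Qed.

Lemma dotp_continuous x : continuous (dotp x).
Proof.
move=> t; apply: (@cvg_sumr _ _ (nbhs t) _ _ _ (fun i y => x ord0 i * y ord0 i)).
move=> i; apply: (@cvgM _ _ (nbhs t)); first exact: cvg_cst.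
exact: coord_continuous.
Qed.

End dotp_theory.

Section boxes.
Variables (R : realType) (m : nat).
Implicit Types x y : 'rV[R]_m.

Lemma box_center x r : 0 <= r -> box x r x.
Proof. by move=> r0 i; rewrite subrr normr0. Qed.

Lemma box_addl x y r : box 0 r y -> box x r (x + y).
Proof. by move=> h i; have := h i; rewrite !mxE addrAC subrr add0r subr0. Qed.

Lemma box0D r r' x y : box 0 r x -> box 0 r' y -> box 0 (r + r') (x + y).
Proof.
move=> hx hy i; have := hx i; have := hy i; rewrite !mxE !subr0 => h h'.
by apply: le_trans (ler_normD _ _) _; exact: lerD.
Qed.

Lemma sub_box r r' : r <= r' -> box (0 : 'rV[R]_m) r `<=` box 0 r'.
Proof. by move=> rr y h i; apply: le_trans rr. Qed.

Lemma box0Z r s x : `|s| <= 1 -> box 0 r x -> box 0 r (s *: x).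
Proof.
move=> s1 h i; rewrite !mxE subr0 normrM; have := h i; rewrite mxE subr0 => hi.
by apply: le_trans hi; rewrite ler_piMl.
Qed.

Lemma box0_small x r : 0 < r -> exists2 d, 0 < d & box 0 r (d *: x).
Proof.
move=> r0; set M := \sum_i `|x ord0 i|.
have M0 : 0 <= M by rewrite sumr_ge0.
have M1 : 0 < 1 + M by lra.
exists (r / (1 + M)) => [|i]; first by rewrite divr_gt0.
rewrite !mxE subr0 normrM gtr0_norm ?divr_gt0//.
rewrite -mulrA mulrC ler_piMl ?(ltW r0)// mulrC ler_pdivrMr// mul1r.
by rewrite /M (bigD1 i)//= addrCA lerDl addr_ge0// sumr_ge0.
Qed.

Lemma nbhs_boxP x (A : set 'rV[R]_m) :
  nbhs x A <-> exists2 r, 0 < r & box x r `<=` A.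
Proof.
split => [/nbhs_ballP[e /= e0 eA]|[r r0 rA]].
  (* The box is closed and the ball open, hence half the radius. *)
  exists (e / 2); first by rewrite divr_gt0.
  move=> y yr; apply: eA; split => // i j; rewrite ord1 /ball/= distrC.
  by apply: le_lt_trans (yr j) _; rewrite ltr_pdivrMr//; lra.
apply/nbhs_ballP; exists r => //= y yr; apply: rA => i.
by have := yr.2 ord0 i; rewrite /ball/= distrC => /ltW.
Qed.

End boxes.

(** * Exponential sums *)

Section exponential_sums.
Variables (R : realType) (m : nat).

(* If g is the first exponent, then f(t + h) - e^<g,h> f(t) has one term
   less and its other coefficients are a_i (e^<ga_i,h> - e^<g,h>). *)
Lemma exp_independent (I : eqType) (s : seq I) (ga : I -> 'rV[R]_m)
    (a : I -> R) (e : R) :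
  0 < e -> uniq (map ga s) ->
  (forall t, box 0 e t -> \sum_(i <- s) a i * expR (dotp (ga i) t) = 0) ->
  forall i, i \in s -> a i = 0.
Proof.
elim: s a e => [//|k s IH] a e e0 /= /andP[ks us] H.
have e2 : 0 < e / 2 by rewrite divr_gt0.
have sa i : i \in s -> a i = 0.
  move=> si.
  have gik : ga i - ga k != 0.
    by rewrite subr_eq0; apply: contraNneq ks => <-; exact: map_f.
  (* The shift h is parallel to [ga i - ga k], so that <ga i - ga k, h> > 0 and the factor of [a i]
     does not vanish. With t and h both in the box of radius e/2, t + h stays where the hypothesis
     applies. *)
  have [d d0 hd] := box0_small (ga i - ga k) e2.
  set h := d *: (ga i - ga k) in hd.
  have : a i * (expR (dotp (ga i) h) - expR (dotp (ga k) h)) = 0.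
    apply: (IH (fun i => a i * (expR (dotp (ga i) h) - expR (dotp (ga k) h)))
      _ e2 us _ i si) => t ht.
    transitivity (a k * expR (dotp (ga k) (t + h)) +
        \sum_(j <- s) a j * expR (dotp (ga j) (t + h)) - expR (dotp (ga k) h) *
        (a k * expR (dotp (ga k) t) + \sum_(j <- s) a j * expR (dotp (ga j) t))).
      rewrite mulrDr opprD addrACA dotpDr expRD mulr_sumr -sumrB.
      rewrite [X in _ = X + _](_ : _ = 0) ?add0r; last by ring.
      by apply: eq_bigr => j _; rewrite dotpDr expRD; ring.
    have := H (t + h); have := H t; rewrite !big_cons => -> => [->|].
    - by rewrite mulr0 subr0.
    - by have := box0D ht hd; rewrite -splitr.
    - by apply: sub_box ht; lra.
  move/eqP; rewrite mulf_eq0 => /orP[/eqP//|].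
  rewrite subr_eq0 => /eqP/expR_inj/eqP; rewrite -subr_eq0 -dotpBl dotpZr.
  rewrite mulf_eq0 gt_eqF//= => /eqP E; move: gik.
  by rewrite (dotp_eq0 (t := ga i - ga k)) ?eqxx// E.
move=> i; rewrite inE => /predU1P[->|]; last exact: sa.
have := H 0 (box_center _ (ltW e0)); rewrite big_cons big_seq big1 ?addr0.
  by rewrite dotp0r expR0 mulr1.
by move=> j js; rewrite sa// mul0r.
Qed.

(** An exponential sum restricted to a line t0 + u d, with p i = <ga i, t0> and q i = <ga i, d>. *)
Lemma is_derive_expsum (I : Type) (s : seq I) (a p q : I -> R) (u : R) :
  is_derive u 1 (fun u => \sum_(i <- s) a i * expR (p i + u * q i))
    (\sum_(i <- s) a i * q i * expR (p i + u * q i)).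
Proof.
elim: s => [|i s IH].
  under eq_fun do rewrite big_nil.
  by rewrite big_nil; exact: is_derive_cst.
under eq_fun do rewrite big_cons.
rewrite big_cons; apply: is_deriveD.
have h : is_derive u 1 (fun u => p i + u * q i) (q i).
  by apply: is_derive_eq; rewrite /GRing.scale /=; ring.
by apply: is_derive_eq; rewrite /GRing.scale /=; ring.
Qed.

Lemma expsum_continuous (I : Type) (s : seq I) (a : I -> R)
    (al : I -> 'rV[R]_m) :
  continuous (fun t => \sum_(i <- s) a i * expR (dotp (al i) t)).
Proof.
move=> t.
apply: (@cvg_sumr _ _ (nbhs t) _ _ _ (fun i t => a i * expR (dotp (al i) t))).
move=> i; apply: (@cvgM _ _ (nbhs t)); first exact: cvg_cst.
apply: continuous_comp; [exact: dotp_continuous|exact: continuous_expR].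
Qed.

End exponential_sums.

(** * Convex hulls, lattice points and interiors *)

Section convex_hulls.
Variables (R : realType) (m : nat).
Implicit Types (V P : set 'rV[R]_m) (x y t : 'rV[R]_m).

Definition segment_closed P :=
  forall x y s, P x -> P y -> 0 <= s <= 1 -> P ((1 - s) *: x + s *: y).

Lemma convex_hull_convex V : segment_closed (convex_hull V).
Proof.
move=> _ _ s [k [v [a [Vv a0 a1 ->]]]] [l [u [b [Vu b0 b1 ->]]]] /andP[s0 s1].
exists (k + l)%N,
  (fun i => match fintype.split i with inl j => v j | inr j => u j end),
  (fun i => match fintype.split i with
            | inl j => (1 - s) * a j | inr j => s * b j end).
split.
- by move=> i; case: fintype.split.
- by move=> i; case: fintype.split => j; rewrite mulr_ge0// subr_ge0.
- rewrite big_split_ord/=.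
  under eq_bigr => i do rewrite (unsplitK (inl i)).
  under [X in _ + X]eq_bigr => i do rewrite (unsplitK (inr i)).
  by rewrite -!mulr_sumr a1 b1; ring.
- rewrite big_split_ord/=.
  under [in RHS]eq_bigr => i do rewrite (unsplitK (inl i)) -scalerA.
  under [X in _ = _ + X]eq_bigr => i do rewrite (unsplitK (inr i)) -scalerA.
  by rewrite -!scaler_sumr.
Qed.

(** Induction on the number of points: the first one is split off and the others, of total weight A,
    are renormalised by 1/A. If A = 0 all their weights vanish. *)
Lemma convex_hull_min V P :
  segment_closed P -> V `<=` P -> convex_hull V `<=` P.
Proof.
move=> cP VP _ [k [v [a [Vv a0 a1 ->]]]].
elim: k v a Vv a0 a1 => [|k IH] v a Vv a0.
  by rewrite big_ord0 => /esym/eqP/[!oner_eq0].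
rewrite !big_ord_recl; set A := \sum_(i < k) _ => a1.
have A0 : 0 <= A by exact: sumr_ge0.
have [AE|An0] := eqVneq A 0.
  have aE := psumr_eq0P (fun i _ => a0 (lift ord0 i)) AE.
  rewrite big1 => [|i _]; last by rewrite aE ?scale0r.
  by move: a1; rewrite AE !addr0 => ->; rewrite scale1r; exact: VP.
rewrite (_ : a ord0 = 1 - A); last by rewrite -a1 addrK.
rewrite [X in _ + X](_ : _ =
    A *: \sum_(i < k) (a (lift ord0 i) / A) *: v (lift ord0 i)).
  have a00 := a0 ord0; apply: cP; [exact: VP| |by apply/andP; split; lra].
  apply: IH => // [i|]; first by rewrite divr_ge0.
  by rewrite -mulr_suml divff.
rewrite scaler_sumr; apply: eq_bigr => i _.
by rewrite scalerA mulrCA divff ?mulr1.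
Qed.

(** Serves to place sums of N points of P in the dilate N P. *)
Lemma convex_average P N (b : 'I_N -> 'rV[R]_m) : segment_closed P -> (0 < N)%N ->
  (forall i, P (b i)) -> P (N%:R^-1 *: \sum_i b i).
Proof.
move=> cP N0 Pb; apply: (convex_hull_min cP (@subset_refl _ P)).
exists N, b, (fun=> N%:R^-1); split => //.
- by rewrite sumr_const card_ord -[_ *+ _]mulr_natr mulVf// pnatr_eq0 -lt0n.
- exact: scaler_sumr.
Qed.

(** A weighted average cannot exceed all the values averaged: otherwise, some weight being positive,
    it would be smaller than itself. *)
Lemma convex_hull_dotp_le V y t :
  convex_hull V y -> exists2 v, V v & dotp y t <= dotp v t.
Proof.
move=> [k [v [a [Vv a0 a1 ->]]]]; apply: contrapT => /forall2NP H.
have lt_v i : dotp (v i) t < dotp (\sum_i a i *: v i) t.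
  by case: (H (v i)) => [/(_ (Vv i))//|/negP]; rewrite -ltNge.
move: lt_v; set M := dotp _ _ => lt_v.
have : \sum_i a i * dotp (v i) t < \sum_i a i * M.
  have [i ai] : exists i, 0 < a i.
    apply: contrapT => /forallNP h; have : \sum_i a i <= 0.
      by apply: sumr_le0 => i _; rewrite leNgt; exact/negP/h.
    by rewrite a1 ler10.
  rewrite (bigD1 i)//= [ltRHS](bigD1 i)//= ltr_leD ?ltr_pM2l//.
  by apply: ler_sum => j _; rewrite ler_wpM2l// ltW.
rewrite -mulr_suml a1 mul1r /M dotp_suml.
by under [X in _ < X]eq_bigr do rewrite dotpZl; rewrite ltxx.
Qed.

Lemma convex_hull_sub V : V `<=` convex_hull V.
Proof.
move=> x Vx; exists 1%N, (fun=> x), (fun=> 1); split => //.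
  by rewrite big_ord_recl big_ord0 addr0.
by rewrite big_ord_recl big_ord0 addr0 scale1r.
Qed.

Lemma convex_hull_bounded V : finite_set V ->
  exists2 B, 0 < B & convex_hull V `<=` box 0 B.
Proof.
move=> fV; pose M := \sum_(v <- fset_set V) \sum_i `|v ord0 i|.
have M0 : 0 <= M by apply: sumr_ge0 => v _; exact: sumr_ge0.
have VM v i : V v -> `|v ord0 i| <= M.
  move=> Vv; apply: (@le_trans _ _ (\sum_i `|v ord0 i|)).
    by rewrite (bigD1 i)//= lerDl sumr_ge0.
  rewrite /M (big_rem v)/=; last by rewrite in_fset_set// mem_set.
  by rewrite lerDl sumr_ge0// => u _; exact: sumr_ge0.
(* M may be 0, while a positive radius is wanted. *)
exists (M + 1); first by lra.
move=> _ [k [v [a [Vv a0 a1 ->]]]] i; rewrite mxE subr0 summxE.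
apply: (le_trans (ler_norm_sum _ _ _)); apply: (@le_trans _ _ (\sum_i a i * M)).
  apply: ler_sum => j _; rewrite mxE normrM ger0_norm// ler_wpM2l//.
  exact: VM.
by rewrite -mulr_suml a1 mul1r; lra.
Qed.

Lemma finite_lattice_box (B : R) : finite_set (box 0 B `&` @lattice R m).
Proof.
have [n Bn] : exists n, B < n%:R by exists (Num.truncn B).+1; exact: truncnS_gt.
pose h (f : {ffun 'I_m -> 'I_(n + n).+1}) : 'rV[R]_m :=
  \row_i ((f i)%:R - n%:R).
apply: (@sub_finite_set _ _ (range h)); last exact/finite_image/finite_finset.
move=> x [xB xZ].
have H i : exists k : 'I_(n + n).+1, x ord0 i = k%:R - n%:R.
  have := xB i; rewrite mxE subr0 => xi.
  have /intrP[z zE] := xZ i.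
  have zn : (`|z| <= n%:Z)%R.
    by rewrite -(ler_int R) intr_norm -zE (le_trans xi)// ltW.
  have [k kE] : exists k : nat, z + n%:Z = k%:Z.
    exists (absz (z + n%:Z)); rewrite gez0_abs//.
    by move: zn; rewrite ler_norml => /andP[]; rewrite -subr_ge0 opprK.
  have kn : (k < (n + n).+1)%N.
    rewrite ltnS -lez_nat -kE PoszD lerD2r.
    by move: zn; rewrite ler_norml => /andP[].
  exists (Ordinal kn) => /=; rewrite zE.
  have := congr1 (fun z : int => z%:~R : R) kE.
  by rewrite /= intrD -!pmulrn => <-; rewrite addrK.
have [f fE] := choice H.
exists (finfun f) => //; apply/rowP => i; rewrite mxE ffunE.
by rewrite -fE.
Qed.

Lemma interior_box P x : P° x <-> exists2 r, 0 < r & box x r `<=` P.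
Proof. exact: nbhs_boxP. Qed.

(** The homothety of centre x and ratio s maps the box of radius r around x0 onto a box of radius s
    r, which convexity keeps in P. *)
Lemma convex_interior P x x0 s : segment_closed P ->
  P x -> P° x0 -> 0 < s <= 1 -> P° ((1 - s) *: x + s *: x0).
Proof.
move=> cP Px /interior_box[r r0 rP] /andP[s0 s1].
apply/interior_box; exists (s * r) => [|y yb]; first exact: mulr_gt0.
have -> : y = (1 - s) *: x + s *: (x0 + s^-1 *: (y - ((1 - s) *: x + s *: x0))).
  rewrite scalerDr scalerA mulfV ?gt_eqF// scale1r addrA.
  by rewrite addrC subrK.
apply: cP => //; last by rewrite ltW.
apply/rP/box_addl => i; have := yb i; rewrite !mxE subr0 => yi.
by rewrite normrM normfV (gtr0_norm s0) ler_pdivrMl.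
Qed.

(* The interior of a convex set with interior points is dense in it. *)
Lemma within_interior_ge0 P (f : 'rV[R]_m -> R) : segment_closed P -> P° !=set0 ->
  {within P, continuous f} -> (forall x, P° x -> 0 <= f x) ->
  forall x, P x -> 0 <= f x.
Proof.
move=> cP [x0 Px0] cf f0 x Px; rewrite leNgt; apply/negP => fx.
have /subspace_continuousP/(_ _ Px) := cf.
move=> /(_ [set y | y < 0]) /=; rewrite nbhs_simpl => /(_ _).
have : nbhs (f x) [set y : R | y < 0].
  by apply: open_nbhs_nbhs; split => //; exact: open_lt.
move=> /[swap] /[apply] /nbhs_boxP[r r0 rP].
have [d d0 hd] := box0_small (x0 - x) r0.
(* s <= 1 stays on the segment from x to x0, and s <= d stays in the box where f is negative on
   P. *)
pose s := Num.min d 1.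
have s0 : 0 < s by rewrite lt_min d0 ltr01.
have s1 : s <= 1 by rewrite ge_min lexx orbT.
have Ps : P° ((1 - s) *: x + s *: x0) by apply: convex_interior; rewrite ?s0.
have := f0 _ Ps; apply/negP; rewrite -ltNge; apply: rP; last exact: interior_subset.
rewrite (_ : _ + _ = x + s *: (x0 - x)); last first.
  by rewrite scalerBl scale1r scalerBr addrA addrAC.
apply: box_addl; rewrite (_ : s *: _ = (s / d) *: (d *: (x0 - x))).
  apply: box0Z hd; rewrite ger0_norm; last by rewrite divr_ge0 ?ltW.
  by rewrite ler_pdivrMr// mul1r ge_min lexx.
by rewrite scalerA -mulrA mulVf ?gt_eqF// mulr1.
Qed.

(** Carries to the boundary the identities between weights, which are computed only where the Gibbs
    formula holds. *)
Lemma within_interior_eq P (f g : 'rV[R]_m -> R) :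
  segment_closed P -> P° !=set0 ->
  {within P, continuous f} -> {within P, continuous g} ->
  (forall x, P° x -> f x = g x) -> forall x, P x -> f x = g x.
Proof.
move=> cP P0 cf cg fg x Px; apply/eqP.
rewrite eq_le -subr_ge0 -[X in _ && X]subr_ge0; apply/andP; split.
  apply: (@within_interior_ge0 P (g \- f)) => //.
    by move=> y; apply: cvgB; [exact: cg|exact: cf].
  by move=> y Py; rewrite /= fg ?subrr.
apply: (@within_interior_ge0 P (f \- g)) => //.
  by move=> y; apply: cvgB; [exact: cf|exact: cg].
by move=> y Py; rewrite /= fg ?subrr.
Qed.

End convex_hulls.

(** * The Gibbs mean as a parametrisation of the interior of the hull *)

Section gibbs_moment_map.
Variables (R : realType) (m : nat) (J : finType).
Variables (al : J -> 'rV[R]_m) (c : J -> R).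
Hypothesis c_gt0 : forall j, 0 < c j.
Implicit Types x y t : 'rV[R]_m.

(** The coefficients are indexed by J itself, so that they can be added to Gibbs weights index by
    index. *)
Definition finite_hull : set 'rV[R]_m :=
  [set y | exists a : J -> R,
    [/\ forall j, 0 <= a j, \sum_j a j = 1 & y = \sum_j a j *: al j]].

Lemma convex_hull_finite : convex_hull (range al) `<=` finite_hull.
Proof.
move=> _ [k [v [a [Vv a0 a1 ->]]]].
have /choice[f fE] : forall i, exists j, al j = v i.
  by move=> i; have [j _ <-] := Vv i; exists j.
exists (fun j => \sum_(i | f i == j) a i); split.
- by move=> j; exact: sumr_ge0.
- by rewrite -[RHS]a1 [RHS](partition_big f xpredT).
rewrite (partition_big f xpredT)//=; apply: eq_bigr => j _.
rewrite scaler_suml; apply: eq_bigr => i /eqP <-.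
by rewrite fE.
Qed.

Lemma finite_hull_convex_hull : finite_hull `<=` convex_hull (range al).
Proof.
move=> y [a [a0 a1 yE]]; pose f (i : 'I_#|J|) : J := enum_val i.
exists #|J|, (al \o f), (a \o f); split => //.
- by move=> i /=; exact: a0.
- by rewrite -a1 (reindex f)//=; apply: onW_bij; exact: enum_val_bij.
- by rewrite yE (reindex f)//=; apply: onW_bij; exact: enum_val_bij.
Qed.

Lemma finite_hull_dotp_le y t :
  finite_hull y -> exists j, dotp y t <= dotp (al j) t.
Proof.
by move=> /finite_hull_convex_hull/(convex_hull_dotp_le t)[_ [j _ <-] h]; exists j.
Qed.

Definition partition_function t := \sum_j c j * expR (dotp (al j) t).

Let Z := partition_function.

Lemma gibbs_term_gt0 t j : 0 < c j * expR (dotp (al j) t).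
Proof. by rewrite mulr_gt0// expR_gt0. Qed.

Definition gibbs_mean t := \sum_j (c j * expR (dotp (al j) t) / Z t) *: al j.

Section interior_point.
Variables (x : 'rV[R]_m) (r : R).
Hypotheses (r_gt0 : 0 < r) (xr : box x r `<=` finite_hull).

(** J is inhabited since its hull contains x; the functional 0 serves only to extract an index. *)
Let j0 : J.
Proof.
by have [j _] := cid (finite_hull_dotp_le 0 (xr (box_center x (ltW r_gt0)))).
Qed.

Lemma partition_function_gt0 t : 0 < Z t.
Proof.
rewrite /Z /partition_function (bigD1 j0)//=.
by rewrite ltr_pwDl ?gibbs_term_gt0// sumr_ge0// => j _; exact/ltW/gibbs_term_gt0.
Qed.

(** Clears the denominator Z. Up to the factor e^(-<y,t>), the right-hand side says that t is a
    critical point of sum_j c_j e^<al_j - y, t>. *)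
Lemma gibbs_mean_eqP t y : gibbs_mean t = y <->
  \sum_j (c j * expR (dotp (al j) t)) *: (al j - y) = 0.
Proof.
have Z0 : Z t != 0 by rewrite gt_eqF// partition_function_gt0.
have -> : \sum_j (c j * expR (dotp (al j) t)) *: (al j - y) =
    Z t *: (gibbs_mean t - y).
  rewrite /gibbs_mean scalerBr scaler_sumr /Z /partition_function scaler_suml -sumrB.
  by apply: eq_bigr => j _; rewrite scalerBr scalerA mulrCA divff// mulr1.
split => [->|/eqP]; first by rewrite subrr scaler0.
by rewrite scaler_eq0 (negPf Z0) subr_eq0 => /eqP.
Qed.

(** Moving x by r along the i-th axis, in the direction of the sign of t_i, stays in the hull and
    raises <., t> by r |t_i|; some al_j does at least as well. *)
Lemma finite_hull_coercive t i : exists j, r * `|t ord0 i| <= dotp (al j - x) t.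
Proof.
pose v : 'rV[R]_m := (r * Num.sg (t ord0 i)) *: delta_mx ord0 i.
have [|j hj] := @finite_hull_dotp_le (x + v) t.
  apply/xr/box_addl => k; rewrite !mxE subr0 eqxx /= normrM normrM gtr0_norm//.
  rewrite -mulrA ler_piMr ?(ltW r_gt0)// mulr_ile1//.
    by rewrite normr_sg; case: eqP.
  by case: (k == i); rewrite ?normr1 ?normr0.
exists j; rewrite dotpBl lerBrDl; apply: le_trans hj; rewrite dotpDl lerD2l.
rewrite dotpZl /dotp (bigD1 i)//= !mxE !eqxx/= mul1r big1 ?addr0.
  by rewrite -mulrA -normrEsg.
by move=> k ki; rewrite !mxE (negPf ki) mul0r.
Qed.

(* The minimiser of the coercive function sum_j c_j exp <al_j - x, t>. *)
Lemma gibbs_mean_surjective : exists t, gibbs_mean t = x.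
Proof.
pose G t := \sum_j c j * expR (dotp (al j - x) t).
have Gterm j t : c j * expR (dotp (al j - x) t) <= G t.
  rewrite /G (bigD1 j)//= lerDl sumr_ge0// => k _.
  by rewrite mulr_ge0 ?expR_ge0 ?(ltW (c_gt0 k)).
(* C dominates every 1 / c_j without taking a maximum. *)
pose C := \sum_j (c j)^-1.
have C0 : 0 < C.
  rewrite /C (bigD1 j0)//= ltr_pwDl ?invr_gt0// sumr_ge0// => j _.
  by rewrite invr_ge0 ltW.
have cC j : 1 <= c j * C.
  rewrite -ler_pdivrMl// mulr1 /C (bigD1 j)//= lerDl sumr_ge0// => k _.
  by rewrite invr_ge0 ltW.
have G0 t : 0 <= G t.
  by rewrite sumr_ge0// => j _; rewrite mulr_ge0 ?expR_ge0 ?(ltW (c_gt0 j)).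
(* Where G t <= G 0, coercivity gives r |t_i| <= <al_j - x, t> <= e^<al_j - x, t> <= C G t <= C G 0
   for some j. *)
pose M := C * G 0 / r.
have M0 : 0 <= M by rewrite divr_ge0 ?mulr_ge0 ?(ltW C0) ?(ltW r_gt0).
have GM t : G t <= G 0 -> box 0 M t.
  move=> h i; rewrite mxE subr0 /M ler_pdivlMr// mulrC.
  have [j hj] := finite_hull_coercive t i; apply: (le_trans hj).
  have e1 := expR_ge1Dx (dotp (al j - x) t).
  have u0 : 0 <= dotp (al j - x) t.
    by apply: le_trans hj; rewrite mulr_ge0 ?(ltW r_gt0).
  apply: (@le_trans _ _ (C * (c j * expR (dotp (al j - x) t)))).
    rewrite mulrA [C * _]mulrC; apply: (@le_trans _ _ (expR (dotp (al j - x) t))).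
      by lra.
    by rewrite ler_peMl ?expR_ge0.
  by rewrite ler_pM2l//; exact: le_trans (Gterm _ _) h.
have cpt : compact (box (0 : 'rV[R]_m) M).
  apply: bounded_closed_compact.
    exists M; split; first exact: num_real.
    move=> y My t ht; rewrite /= [leLHS]mx_normrE; apply: (le_trans _ (ltW My)).
    apply: bigmax_le => // -[i i'] _ /=; rewrite ord1.
    by have := ht i'; rewrite mxE subr0.
  rewrite (_ : box 0 M = \bigcap_(i in [set: 'I_m])
      ((fun t : 'rV[R]_m => `|t ord0 i|) @^-1` [set z | z <= M])); last first.
    apply/seteqP; split => t h i; first by move=> _; have := h i; rewrite mxE subr0.
    by have := h i I; rewrite mxE subr0.
  apply: closed_bigI => i _; apply: closed_comp; last exact: closed_le.
  move=> t _; apply: continuous_comp; first exact: coord_continuous.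
  exact: norm_continuous.
have [t0 _ t0min] : exists2 t0, t0 \in box 0 M &
    forall t, t \in box 0 M -> G t0 <= G t.
  apply: EVT_min_rV => //; first by exists 0; exact: box_center.
  by apply: continuous_subspaceT; exact: expsum_continuous.
have {t0min} Gmin t : G t0 <= G t.
  case: (lerP (G t) (G 0)) => [h|h]; first by apply: t0min; apply: mem_set; exact: GM.
  by apply: le_trans (ltW h); apply: t0min; apply: mem_set; exact: box_center.
exists t0; apply/gibbs_mean_eqP.
set w := (X in X = 0).
(* On the line t0 + u d, G is minimal at u = 0, where its derivative is e^(-<x,t0>) <w, d>. Taking d
   = w afterwards gives w = 0. *)
have wd d : dotp w d = 0.
  pose f u := \sum_j c j * expR (dotp (al j - x) t0 + u * dotp (al j - x) d).
  have fE u : f u = G (t0 + u *: d).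
    by apply: eq_bigr => j _; rewrite dotpDr dotpZr.
  have df (u : R) := is_derive_expsum (index_enum J) c
    (fun j => dotp (al j - x) t0) (fun j => dotp (al j - x) d) u.
  have d0 : is_derive (0 : R) 1 f 0.
    apply: (@derive1_at_min R f (-1) 1); first by lra.
    - by move=> u _; exact: ex_derive.
    - by rewrite in_itv/=; lra.
    - by move=> u _; rewrite !fE scale0r addr0.
  have E : 0 = \sum_j c j * dotp (al j - x) d *
      expR (dotp (al j - x) t0 + 0 * dotp (al j - x) d).
    exact: etrans (esym (@derive_val _ _ _ _ _ _ _ d0))
      (@derive_val _ _ _ _ _ _ _ (df 0)).
  transitivity (expR (dotp x t0) * 0); last by rewrite mulr0.
  rewrite [in RHS]E mulr_sumr dotp_suml; apply: eq_bigr => j _.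
  rewrite mul0r addr0 dotpZl [dotp (al j - x) t0]dotpBl expRB.
  by field; rewrite gt_eqF ?expR_gt0.
by apply: dotp_eq0; rewrite wd.
Qed.

(* With u_j = <al_j - x, t' - t> and p_j the weights at t, the difference of
   the two equations is sum_j p_j u_j (e^{u_j} - 1) = 0, all terms being >= 0. *)
Lemma gibbs_mean_injective t t' :
  gibbs_mean t = x -> gibbs_mean t' = x -> t = t'.
Proof.
move=> /gibbs_mean_eqP E /gibbs_mean_eqP E'.
pose d := t' - t; pose u j := dotp (al j - x) d.
have {}E : \sum_j c j * expR (dotp (al j) t) * u j = 0.
  transitivity (dotp 0 d); last by rewrite dotp0l.
  by rewrite -E dotp_suml; apply: eq_bigr => j _; rewrite dotpZl.
have {}E' : \sum_j c j * expR (dotp (al j) t) * expR (u j) * u j = 0.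
  transitivity (expR (- dotp x d) * dotp 0 d); last by rewrite dotp0l mulr0.
  rewrite -E' dotp_suml mulr_sumr; apply: eq_bigr => j _; rewrite dotpZl -/(u j).
  have -> : dotp (al j) t' = dotp (al j) t + u j + dotp x d.
    by rewrite /u dotpBl /d !dotpBr; ring.
  rewrite !expRD expRN; field.
  by rewrite gt_eqF ?expR_gt0.
have pos (z : R) : 0 <= z * (expR z - 1).
  case: (lerP 0 z) => z0.
    by rewrite mulr_ge0// subr_ge0 -expR0 ler_expR.
  by rewrite mulr_le0// ?(ltW z0)// subr_le0 -expR0 ler_expR ltW.
have u0 j : u j = 0.
  have : \sum_j c j * expR (dotp (al j) t) * (u j * (expR (u j) - 1)) = 0.
    transitivity (\sum_j c j * expR (dotp (al j) t) * expR (u j) * u j -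
       \sum_j c j * expR (dotp (al j) t) * u j); last by rewrite E E' subrr.
    by rewrite -sumrB; apply: eq_bigr => k _; ring.
  move/eqP; rewrite psumr_eq0 => [/allP/(_ j (mem_index_enum j))/=|k _]; last first.
    by rewrite mulr_ge0 ?pos// ltW ?gibbs_term_gt0.
  rewrite mulf_eq0 gt_eqF ?gibbs_term_gt0//= mulf_eq0 => /orP[/eqP//|].
  by rewrite subr_eq0 -expR0 => /eqP/expR_inj.
(* Now d is orthogonal to every al_j - x. But x + e d lies in the hull, so some j has <al_j - x, d>
   >= e <d, d>, and d = 0. *)
have [e e0 hd] := box0_small d r_gt0.
have [j] := finite_hull_dotp_le d (xr (box_addl x hd)).
rewrite -subr_ge0 -dotpBl opprD addrA dotpBl -/(u j) u0 sub0r dotpZl oppr_ge0.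
rewrite pmulr_rle0// => /dotp_eq0/eqP; rewrite subr_eq0 => /eqP ->//.
Qed.

(* If x = sum_j b_j al_j and the weights at t are all at least p, then
   gibbs_mean t + p (y - x) is again a convex combination for y in the box. *)
Lemma gibbs_mean_interior t :
  exists2 e, 0 < e & box (gibbs_mean t) e `<=` finite_hull.
Proof.
pose w j := c j * expR (dotp (al j) t) / Z t.
have Z0 := partition_function_gt0 t.
have w0 j : 0 < w j by rewrite divr_gt0 ?gibbs_term_gt0.
have w1 : \sum_j w j = 1 by rewrite -mulr_suml divff// gt_eqF.
(* All weights being at most 1, their product is a positive lower bound for each of them. *)
pose p := \prod_j w j.
have wle1 j : w j <= 1.
  by rewrite -w1 (bigD1 j)//= lerDl sumr_ge0// => k _; exact: ltW.
have p0 : 0 < p by exact: prodr_gt0.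
have pw j : p <= w j.
  rewrite /p (bigD1 j)//= ler_piMr ?(ltW (w0 j))// prodr_ile1// => k _.
  by rewrite wle1 ltW.
have [b [b0 b1 xE]] := xr (box_center x (ltW r_gt0)).
have ble1 j : b j <= 1 by rewrite -b1 (bigD1 j)//= lerDl sumr_ge0.
exists (p * r) => [|y hy]; first exact: mulr_gt0.
have : finite_hull (x + p^-1 *: (y - gibbs_mean t)).
  apply/xr/box_addl => i; have := hy i; rewrite !mxE subr0 => hi.
  by rewrite normrM normfV (gtr0_norm p0) ler_pdivrMl.
move=> [a [a0 a1 aE]].
have yE : y = gibbs_mean t - p *: x + p *: (x + p^-1 *: (y - gibbs_mean t)).
  rewrite scalerDr scalerA mulfV ?gt_eqF// scale1r addrA subrK.
  by rewrite addrC subrK.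
exists (fun j => w j - p * b j + p * a j); split.
- move=> j; rewrite addr_ge0 ?mulr_ge0 ?(ltW p0)// subr_ge0.
  by apply: le_trans (pw j); rewrite ler_piMr ?(ltW p0).
- by rewrite big_split/= sumrB -!mulr_sumr w1 b1 a1 mulr1 subrK.
rewrite {1}yE aE {1}xE /gibbs_mean !scaler_sumr -sumrB -big_split/=.
by apply: eq_bigr => j _; rewrite !scalerA -scalerBl -scalerDl.
Qed.

End interior_point.

(** [gibbs_mean] is grad log Z, so the hypothesis reads grad F = N F grad log Z, multiplied out so
    as not to divide by F. Hence F / Z^N has zero derivative along each ray u t and keeps its value
    at 0. *)
Lemma log_derivative_constant (K : finType) (ga : K -> 'rV[R]_m) (b : K -> R) N :
  (0 < N)%N -> (forall t, 0 < Z t) ->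
  (forall t, \sum_k (b k * expR (dotp (ga k) t)) *: ga k =
     (\sum_k b k * expR (dotp (ga k) t) * N%:R) *: gibbs_mean t) ->
  exists q, forall t, \sum_k b k * expR (dotp (ga k) t) = q * Z t ^+ N.
Proof.
move=> N0 Z0 H.
pose F t := \sum_k b k * expR (dotp (ga k) t).
suff D t : F t / Z t ^+ N = F 0 / Z 0 ^+ N.
  exists (F 0 / Z 0 ^+ N) => t; rewrite -(D t) mulfVK// expf_neq0// gt_eqF//.
pose f (u : R) := \sum_k b k * expR (0 + u * dotp (ga k) t).
pose z (u : R) := \sum_j c j * expR (0 + u * dotp (al j) t).
have fE u : f u = F (u *: t).
  by apply: eq_bigr => k _; rewrite dotpZr add0r.
have zE u : z u = Z (u *: t).
  by apply: eq_bigr => k _; rewrite dotpZr add0r.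
have df (u : R) := is_derive_expsum (index_enum K) b (fun=> 0)
  (fun k => dotp (ga k) t) u.
have dz (u : R) := is_derive_expsum (index_enum J) c (fun=> 0)
  (fun j => dotp (al j) t) u.
have z0 u : z u != 0 by rewrite zE gt_eqF.
have dphi (u : R) : is_derive u 1 (f * (fun v : R => (z v)^-1) ^+ N : R -> R) 0.
  have dv := is_deriveV (z0 u) (dz u).
  have := is_deriveM (df u) (is_deriveX N dv).
  move=> /is_derive_eq; apply; rewrite /GRing.scale /=.
  rewrite -/(f u) -/(z u).
  set fd := \sum_k b k * _ * _; set zd := \sum_j c j * _ * _.
  have E : z u * fd = N%:R * f u * zd.
    have := congr1 (fun v => dotp v t) (H (u *: t)).
    rewrite /= dotp_suml dotpZl /gibbs_mean dotp_suml -mulr_suml -/(F _) -fE -zE.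
    rewrite (_ : \sum_(i <- _) _ = fd); last first.
      by rewrite /fd; apply: eq_bigr => k _; rewrite dotpZl dotpZr add0r mulrAC.
    move=> ->; rewrite mulrCA [f u * _]mulrC; congr (_ * _).
    rewrite mulr_sumr; apply: eq_bigr => j _; rewrite dotpZl dotpZr add0r.
    rewrite mulrA mulrCA mulfV// mulr1; ring.
  case: N N0 H E => // n _ _ E /=.
  transitivity ((z u)^-1 ^+ n * (z u ^- 2) * (z u * fd - n.+1%:R * f u * zd)).
    by rewrite fctE [_^-1 ^+ n.+1]exprS exprVn; field; rewrite expf_neq0 ?z0.
  by rewrite E subrr mulr0.
have := @is_derive_0_is_cst R _ 1 0 dphi.
by rewrite !fctE !exprVn !fE !zE scale1r scale0r.
Qed.

End gibbs_moment_map.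

(** * Sums over finite sets and over N-tuples *)

Section finite_enumeration.

(** Turns S and S_N into injective families over finite types, and the sums over these sets into
    ordinary indexed sums. *)
Lemma finite_set_enum (T : choiceType) (A : set T) : finite_set A ->
  exists (J : finType) (al : J -> T), injective al /\ range al = A.
Proof.
move=> fA; exists (fset_set A), val; split; first exact: val_inj.
apply/seteqP; split => [_ [x _ <-]|x Ax].
  by have := valP x; rewrite in_fset_set// => /set_mem.
have xA : x \in fset_set A by rewrite in_fset_set// mem_set.
by exists [` xA]%fset.
Qed.

Lemma fsbig_finimage (R : Type) (idx : R) (op : Monoid.com_law idx)
    (J : finType) (T : choiceType) (al : J -> T) (D : pred J) (F : T -> R) :
  injective al ->
  \big[op/idx]_(x \in al @` [set j | D j]) F x = \big[op/idx]_(j | D j) F (al j).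
Proof.
move=> inj; rewrite fsbig_image; last by move=> i j _ _; exact: inj.
rewrite -[RHS]big_enum [RHS]fsbig_seq ?enum_uniq//.
by apply: eq_fsbigl; apply/seteqP; split => j /=; rewrite mem_enum.
Qed.

Lemma fsbig_range (R : Type) (idx : R) (op : Monoid.com_law idx)
    (J : finType) (T : choiceType) (al : J -> T) (F : T -> R) :
  injective al -> \big[op/idx]_(x \in range al) F x = \big[op/idx]_j F (al j).
Proof.
by move=> inj; rewrite -(fsbig_finimage _ predT)//; apply: eq_fsbigl;
  congr image; apply/seteqP; split.
Qed.

End finite_enumeration.

Section multinomial_sums.
Variables (R : realType) (J : finType) (N : nat) (a : J -> R).
Hypothesis a1 : \sum_j a j = 1.

Lemma sum_ffun_prod : \sum_(f : {ffun 'I_N -> J}) \prod_i a (f i) = 1.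
Proof. by rewrite -(bigA_distr_bigA (fun _ => a)) big1. Qed.

(** The mean of a sum of N independent variables. For each position k the factor b is absorbed into
    the k-th sum, and the other N - 1 sums equal 1. *)
Lemma sum_ffun_prod_mean (b : J -> R) :
  \sum_(f : {ffun 'I_N -> J}) (\prod_i a (f i)) * (\sum_i b (f i)) =
    N%:R * \sum_j a j * b j.
Proof.
under eq_bigr do rewrite mulr_sumr.
rewrite exchange_big/= -[N in RHS]card_ord mulr_natl -sumr_const.
apply: eq_bigr => k _.
transitivity (\sum_(f : {ffun 'I_N -> J})
    \prod_i (a (f i) * (if i == k then b (f i) else 1))).
  apply: eq_bigr => f _; rewrite big_split/=; congr (_ * _).
  by rewrite (bigD1 k)//= eqxx big1 ?mulr1// => i /negPf ->.
rewrite -(bigA_distr_bigA (fun i j => a j * (if i == k then b j else 1))).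
rewrite (bigD1 k)//= eqxx [X in _ * X]big1 ?mulr1// => i /negPf ->.
by under eq_bigr do rewrite mulr1.
Qed.

End multinomial_sums.

(** * The weights m^gamma on P and on its interior *)

Section bergman_bernstein.
Variables (R : realType) (m : nat) (P V : set 'rV[R]_m).
Variables (c : 'rV[R]_m -> R) (w : 'rV[R]_m -> 'rV[R]_m -> R) (N : nat).
Hypotheses (V_fin : finite_set V) (V_lattice : V `<=` lattice)
  (PE : P = convex_hull V) (P_interior : P° !=set0)
  (c_gt0 : forall alpha, lattice_points P alpha -> 0 < c alpha)
  (N_gt0 : (0 < N)%N) (w_weights : bernstein_weights P c w).
Variables (J K : finType) (al : J -> 'rV[R]_m) (ga : K -> 'rV[R]_m).
Hypotheses (al_inj : injective al) (alE : range al = lattice_points P)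
  (ga_inj : injective ga) (gaE : range ga = dilated_lattice_points P N).

Let cj (j : J) : R := c (al j).
Let Z := partition_function al cj.
Let tau := inverse_moment_map P c.
Let mk k x := weight_power P w N (ga k) x.
Let ck k : R := \sum_(f : {ffun 'I_N -> J} | \sum_i al (f i) == ga k)
  \prod_i cj (f i).

Let S_al j : lattice_points P (al j).
Proof. by rewrite -alE; exists j. Qed.

Let cj_gt0 j : 0 < cj j.
Proof. exact/c_gt0/S_al. Qed.

Let P_convex : segment_closed P.
Proof. by rewrite PE; exact: convex_hull_convex. Qed.

(** The points of V are lattice points of P, hence among the al_j: the hull of the exponents is all
    of P. *)
Let P_finite_hull : P = finite_hull al.
Proof.
apply/seteqP; split => [x|x /finite_hull_convex_hull].
  rewrite PE => Px; apply: convex_hull_finite; move: x Px.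
  apply: convex_hull_min; first exact: convex_hull_convex.
  move=> v Vv; apply: convex_hull_sub; rewrite alE; split; last exact: V_lattice.
  by rewrite PE; exact: convex_hull_sub.
by apply: (convex_hull_min P_convex) => y; rewrite alE => -[].
Qed.

Let interior_hull x : P° x -> exists2 r, 0 < r & box x r `<=` finite_hull al.
Proof. by rewrite -P_finite_hull => /interior_box. Qed.

Let Z_gt0 t : 0 < Z t.
Proof.
have [x /interior_hull[r r0 rP]] := P_interior.
exact: (partition_function_gt0 cj_gt0 r0 rP).
Qed.

Let gibbs_weightE j t :
  gibbs_weight P c (al j) t = cj j * expR (dotp (al j) t) / Z t.
Proof. by rewrite /gibbs_weight -alE fsbig_range. Qed.

Let moment_mapE t : moment_map P c t = gibbs_mean al cj t.
Proof.
rewrite /moment_map -alE fsbig_range//; apply: eq_bigr => j _.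
by rewrite gibbs_weightE.
Qed.

(** [inverse_moment_map] is a choice with default value 0; surjectivity onto the interior ensures
    that a true preimage is chosen. *)
Let tauK x : P° x -> moment_map P c (tau x) = x.
Proof.
move=> /interior_hull[r r0 rP].
have [t tE] := gibbs_mean_surjective cj_gt0 r0 rP.
apply: (@xgetPex _ 0 [set t | moment_map P c t = x]).
by exists t; rewrite /= moment_mapE.
Qed.

Let interior_moment t : P° (moment_map P c t).
Proof.
have [x /interior_hull[r r0 rP]] := P_interior.
apply/interior_box; rewrite moment_mapE.
have [e e0 eP] := gibbs_mean_interior cj_gt0 r0 rP t.
by exists e => //; rewrite P_finite_hull.
Qed.

Let momentK t : tau (moment_map P c t) = t.
Proof.
have Pt := interior_moment t; have [r r0 rP] := interior_hull Pt.
apply: (gibbs_mean_injective cj_gt0 r0 rP); rewrite -moment_mapE//.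
exact: tauK.
Qed.

Let w_interior j x : P° x ->
  w (al j) x = cj j * expR (dotp (al j) (tau x)) / Z (tau x).
Proof. by move=> Px; rewrite (w_weights (S_al j)).2// gibbs_weightE. Qed.

Let w_continuous j : {within P, continuous (w (al j))}.
Proof. exact: (w_weights (S_al j)).1. Qed.

Let w_ge0 j x : P x -> 0 <= w (al j) x.
Proof.
apply: within_interior_ge0 => // y Py; rewrite w_interior//.
by apply: divr_ge0; apply/ltW => //; exact: gibbs_term_gt0.
Qed.

Let w_sum x : P x -> \sum_j w (al j) x = 1.
Proof.
apply: (@within_interior_eq _ _ P (fun x => \sum_j w (al j) x) (cst 1)) => //.
- by move=> y; apply: cvg_sumr => j; exact: w_continuous.
- exact: cst_continuous.
- move=> y Py; under eq_bigr do rewrite w_interior//.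
  by rewrite -mulr_suml; exact: divff (lt0r_neq0 (Z_gt0 _)).
Qed.

Let w_mean x i : P x -> \sum_j w (al j) x * al j ord0 i = x ord0 i.
Proof.
apply: (@within_interior_eq _ _ P (fun x => \sum_j w (al j) x * al j ord0 i)
  (fun x => x ord0 i)) => //.
- move=> y; apply: cvg_sumr => j; apply: cvgM; last exact: cvg_cst.
  exact: w_continuous.
- by apply: continuous_subspaceT; exact: coord_continuous.
- move=> y Py; rewrite -[in RHS](tauK Py) moment_mapE /gibbs_mean summxE.
  by apply: eq_bigr => j _; rewrite w_interior// mxE.
Qed.

Let mkE k x : mk k x = \sum_(f : {ffun 'I_N -> J} | \sum_i al (f i) == ga k)
  \prod_i w (al (f i)) x.
Proof.
pose h (f : {ffun 'I_N -> J}) : {ffun 'I_N -> 'rV[R]_m} := [ffun i => al (f i)].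
have h_inj : injective h.
  move=> f g /ffunP fg; apply/ffunP => i; apply: al_inj.
  by have := fg i; rewrite !ffunE.
rewrite /mk /weight_power (_ : [set _ | _] =
    h @` [set f : {ffun 'I_N -> J} | \sum_i al (f i) == ga k]).
  rewrite fsbig_finimage//; apply: eq_bigr => f _; apply: eq_bigr => i _.
  by rewrite ffunE.
apply/seteqP; split => [b [bS bk]|_ [f /= /eqP fk <-]].
  have /choice[f fE] : forall i, exists j, al j = b i.
    by move=> i; have := bS i; rewrite -alE => -[j _ <-]; exists j.
  exists (finfun f); last by apply/ffunP => i; rewrite !ffunE.
  by rewrite /= -bk; apply/eqP; apply: eq_bigr => i _; rewrite ffunE.
split => [i|]; first by rewrite ffunE.
by rewrite -fk; apply: eq_bigr => i _; rewrite ffunE.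
Qed.

(** A sum of N points of S lies in S_N, which gives a map [sigma] from N-tuples to indices. Nothing
    is claimed about its surjectivity: a fibre may be empty, and then [ck k] is 0. *)
Let total (f : {ffun 'I_N -> J}) : {k | ga k = \sum_i al (f i)}.
Proof.
apply: cid; suff : range ga (\sum_i al (f i)) by move=> [k _ <-]; exists k.
rewrite gaE; split.
  exists (N%:R^-1 *: \sum_i al (f i)).
    by apply: convex_average => // i; have [] := S_al (f i).
  by rewrite scalerA divff ?scale1r// pnatr_eq0 -lt0n.
by move=> i; rewrite summxE rpred_sum// => j _; have [_] := S_al (f j); exact.
Qed.

Let sigma f := sval (total f).

Let sigmaE f : ga (sigma f) = \sum_i al (f i).
Proof. exact: svalP (total f). Qed.

Let sum_sigma (T : Type) (idx : T) (op : Monoid.com_law idx)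
    (F : {ffun 'I_N -> J} -> T) :
  \big[op/idx]_f F f =
  \big[op/idx]_k
    \big[op/idx]_(f : {ffun 'I_N -> J} | \sum_i al (f i) == ga k) F f.
Proof.
rewrite (partition_big sigma xpredT)//=; apply: eq_bigr => k _.
by apply: eq_bigl => f; rewrite -sigmaE (inj_eq ga_inj).
Qed.

Let mk_ge0 k x : P x -> 0 <= mk k x.
Proof.
by move=> Px; rewrite mkE sumr_ge0// => f _; rewrite prodr_ge0// => i _; exact: w_ge0.
Qed.

Let mk_sum x : P x -> \sum_k mk k x = 1.
Proof.
move=> Px; rewrite -(sum_ffun_prod N (w_sum Px)) sum_sigma.
by apply: eq_bigr => k _; rewrite mkE.
Qed.

Let mk_le1 k x : P x -> mk k x <= 1.
Proof.
move=> Px; rewrite -(mk_sum Px) (bigD1 k)//= lerDl sumr_ge0// => i _.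
exact: mk_ge0.
Qed.

Let mk_mean x i : P x -> \sum_k mk k x * ga k ord0 i = N%:R * x ord0 i.
Proof.
move=> Px; rewrite -(w_mean i Px) -(sum_ffun_prod_mean N (w_sum Px)) sum_sigma.
apply: eq_bigr => k _; rewrite mkE mulr_suml; apply: eq_bigr => f /eqP <-.
by rewrite summxE.
Qed.

Let mk_interior k x : P° x ->
  mk k x = ck k * expR (dotp (ga k) (tau x)) / Z (tau x) ^+ N.
Proof.
move=> Px; rewrite mkE /ck !mulr_suml; apply: eq_bigr => f /eqP <-.
under eq_bigr do rewrite w_interior//.
rewrite !big_split/= prodfV prodr_const card_ord; congr (_ * _ / _).
by rewrite dotp_suml expR_sum.
Qed.

Let mk_moment k t :
  mk k (moment_map P c t) = ck k * expR (dotp (ga k) t) / Z t ^+ N.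
Proof. by rewrite mk_interior ?momentK. Qed.

Let ZN_neq0 t : Z t ^+ N != 0.
Proof. by rewrite expf_neq0// gt_eqF. Qed.

(** Read off from total mass 1 at the point [moment_map P c t], without expanding the power Z^N
    again. *)
Let ck_sum t : \sum_k ck k * expR (dotp (ga k) t) = Z t ^+ N.
Proof.
have := mk_sum (interior_subset (interior_moment t)).
under eq_bigr do rewrite mk_moment.
by rewrite -mulr_suml => /(congr1 ( *%R^~ (Z t ^+ N))); rewrite mulfVK// mul1r.
Qed.

(** * Positivity of R_N and the coefficients of the measures *)

Let RNk k := RN P w N (ga k).

Let RN_ge0 k : 0 <= RNk k.
Proof. by apply: fine_integral_ge0 => x; exact: mk_ge0. Qed.

(** If no N-tuple had total [ga k], then m^gamma would vanish identically and so would R_N(gamma).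
    Hence the sum of positive products defining [ck k] is not empty. *)
Let ck_gt0 k : bergman_defined P w N -> 0 < ck k.
Proof.
move=> bd; have /eqP Rk : RNk k != 0 by apply: bd; rewrite -gaE; exists k.
have [f fk] : exists f : {ffun 'I_N -> J}, \sum_i al (f i) == ga k.
  apply: contrapT => /forallNP Nf; apply: Rk; rewrite /RNk /RN.
  have [mu <- _] := @lebesgue_rV_measure R m; rewrite integral0_eq// => x _.
  by rewrite -/(mk k x) mkE big_pred0// => f; apply/negP/Nf.
rewrite /ck (bigD1 f)//= ltr_pwDl ?prodr_gt0//.
by rewrite sumr_ge0// => g _; rewrite prodr_ge0// => i _; exact: ltW.
Qed.

(** The point N al_j is the total of the constant tuple j, so its m^gamma is positive at an interior
    point and, by continuity, at least half that value on a small box. This excludes the constant 0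
    for R_N. *)
Let RN_gt0_ex : exists k, 0 < RNk k.
Proof.
have [x0 Px0] := P_interior; have [r r0 rP] := interior_hull Px0.
have [j _] := finite_hull_dotp_le 0 (rP _ (box_center x0 (ltW r0))).
pose k := sigma [ffun=> j]; exists k.
have mk0 : 0 < mk k x0.
  rewrite mk_interior// divr_gt0 ?exprn_gt0// mulr_gt0 ?expR_gt0//.
  rewrite /ck (bigD1 [ffun=> j])/= ?sigmaE// ltr_pwDl ?prodr_gt0//.
  by rewrite sumr_ge0// => g _; rewrite prodr_ge0// => i _; exact: ltW.
have mk_cont : {within P, continuous (mk k)}.
  pose fs := [seq f : {ffun 'I_N -> J} <- index_enum _ | \sum_i al (f i) == ga k].
  rewrite (_ : mk k = fun x => \sum_(f <- fs) \prod_i w (al (f i)) x).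
    by move=> y; apply: cvg_sumr => f; apply: cvg_prodr => i; exact: w_continuous.
  by apply/funext => y; rewrite mkE big_filter.
have [B B0 PB] := convex_hull_bounded V_fin.
have /subspace_continuousP/(_ _ (interior_subset Px0)) := mk_cont.
move=> /(_ [set z | mk k x0 / 2 < z]) /=; rewrite nbhs_simpl => /(_ _).
have : nbhs (mk k x0) [set z : R | mk k x0 / 2 < z].
  by apply: open_nbhs_nbhs; split; [exact: open_gt|rewrite /= ltr_pdivrMr//; lra].
move=> /[swap] /[apply] near0.
have : nbhs x0 (P `&` [set y | mk k x0 / 2 < mk k y]).
  by apply: filterS2 Px0 near0 => y Py h; split => //; exact: h.
move=> /nbhs_boxP[e e0 eP].
apply: (@fine_integral_gt0 R m P (mk k) x0 0 e B (mk k x0 / 2)) => //.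
- by rewrite divr_gt0.
- by move=> y Py; rewrite mk_ge0// mk_le1.
- by rewrite PE.
- by move=> y /eP[].
- by move=> y /eP[_ /ltW].
Qed.

Let PiNE x : PiN P w N x = \sum_k mk k x / RNk k.
Proof. by rewrite /PiN -gaE fsbig_range. Qed.

Let nuE x : bergman_bernstein_measure P w N x = fun X =>
  (\sum_k ((PiN P w N x)^-1 * (mk k x / RNk k))%:E * \d_(dilation N (ga k)) X)%E.
Proof.
apply/funext => X; rewrite /bergman_bernstein_measure /discrete_measure -gaE.
exact: fsbig_range.
Qed.

Let coef_ge0 x k : P x -> 0 <= (PiN P w N x)^-1 * (mk k x / RNk k).
Proof.
move=> Px; rewrite mulr_ge0 ?divr_ge0 ?mk_ge0// invr_ge0 PiNE sumr_ge0// => i _.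
by rewrite divr_ge0// mk_ge0.
Qed.

Let barycenterE x i : P x -> barycenter (bergman_bernstein_measure P w N x) ord0 i =
  \sum_k ((PiN P w N x)^-1 * (mk k x / RNk k)) * (N%:R^-1 * ga k ord0 i).
Proof.
move=> Px; rewrite mxE nuE integral_atomic.
- by apply: eq_bigr => k _; rewrite mxE.
- by move=> k; exact: coef_ge0.
- exact: measurable_coord.
Qed.

Let dilatedE x X : P x -> measurable X -> dilated_bernstein_measure P w N x X =
  (\sum_k (mk k x)%:E * \d_(dilation N (ga k)) X)%E.
Proof.
move=> Px mX; rewrite /dilated_bernstein_measure /pushforward.
rewrite (_ : bernstein_measure P w x =
    fun X => (\sum_j (w (al j) x)%:E * \d_(al j) X)%E); last first.
  by apply/funext => Y; rewrite /bernstein_measure /discrete_measure -alE fsbig_range.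
rewrite convolution_power_atomic//; last 2 first.
- by move=> j; exact: w_ge0.
- by rewrite -[Y in measurable Y]setTI; exact: measurable_dilation.
rewrite sum_sigma; apply: eq_bigr => k _.
rewrite mkE -sumEFin ge0_sume_distrl; last first.
  by move=> f _; rewrite lee_fin prodr_ge0// => i _; exact: w_ge0.
by apply: eq_bigr => f /eqP ->.
Qed.

Let R_constant := exists q : R, forall k, RNk k = q.

Let constant_RN_gt0 q : (forall k, RNk k = q) -> 0 < q.
Proof. by move=> Rq; have [k] := RN_gt0_ex; rewrite Rq. Qed.

Let constant_defined : R_constant -> bergman_defined P w N.
Proof.
move=> [q Rq] g; rewrite -gaE => -[k _ <-].
by rewrite -/(RNk k) Rq gt_eqF// constant_RN_gt0.
Qed.

Let constant_PiN q x : (forall k, RNk k = q) -> P x -> PiN P w N x = q^-1.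
Proof.
move=> Rq Px; rewrite PiNE; under eq_bigr do rewrite Rq.
by rewrite -mulr_suml mk_sum// mul1r.
Qed.

Let constant_coef q x k : (forall k, RNk k = q) -> P x ->
  (PiN P w N x)^-1 * (mk k x / RNk k) = mk k x.
Proof.
move=> Rq Px; rewrite (constant_PiN Rq)// Rq invrK mulrC mulfVK//.
by rewrite gt_eqF// constant_RN_gt0.
Qed.

(** The common end of the implications from constant Pi_N and from the barycenter: both reach F = q
    Z^N. Cancelling [ck k] is where [bergman_defined] enters. *)
Let exp_identity_constant q : bergman_defined P w N ->
  (forall t, \sum_k ck k / RNk k * expR (dotp (ga k) t) = q * Z t ^+ N) ->
  R_constant.
Proof.
move=> bd H; exists q^-1 => k.
have uK : uniq (map ga (index_enum K)).
  by rewrite map_inj_uniq ?index_enum_uniq.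
have := @exp_independent R m K _ ga (fun k => ck k / RNk k - q * ck k) 1 ltr01 uK
  _ k (mem_index_enum k).
move=> /(_ _)/eqP; rewrite subr_eq0 => /(_ _)/eqP E.
have {}E : ck k / RNk k = q * ck k.
  apply: E => t _; rewrite -[RHS](subrr (q * Z t ^+ N)) -{1}H.
  rewrite -ck_sum mulr_sumr -sumrB.
  by apply: eq_bigr => i _; rewrite mulrBl mulrA.
have ck0 : ck k != 0 by rewrite gt_eqF// ck_gt0.
by apply: invr_inj; rewrite invrK; apply: (mulfI ck0); rewrite E mulrC.
Qed.

(** * The three equivalences *)

Lemma RN_constant_iff_PiN_constant :
  R_constant <-> bergman_defined P w N /\
    exists q : R, forall x, P x -> PiN P w N x = q.
Proof.
split => [Rc|[bd [q Pq]]].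
  split; first exact: constant_defined.
  by have [q Rq] := Rc; exists q^-1 => x; exact: constant_PiN.
apply: (@exp_identity_constant q) => // t.
rewrite -(Pq _ (interior_subset (interior_moment t))) PiNE mulr_suml.
apply: eq_bigr => k _; rewrite mk_moment mulrAC -!mulrA [_ * Z t ^+ N]mulrC.
by rewrite mulKf// mulrAC mulrA.
Qed.

Lemma RN_constant_iff_barycenter :
  R_constant <-> bergman_defined P w N /\
    forall x, P x -> barycenter (bergman_bernstein_measure P w N x) = x.
Proof.
have NR : N%:R != 0 :> R by rewrite pnatr_eq0 -lt0n.
split => [Rc|[bd H]].
  split; first exact: constant_defined.
  have [q Rq] := Rc; move=> x Px; apply/rowP => i; rewrite barycenterE//.
  under eq_bigr do rewrite (constant_coef _ Rq)// mulrCA.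
  by rewrite -mulr_sumr mk_mean// mulKf.
pose b k := ck k / RNk k.
have R_gt0 k : 0 < RNk k.
  by rewrite lt_neqAle RN_ge0 eq_sym andbT; apply: bd; rewrite -gaE; exists k.
(* The barycenter equation at x = [moment_map P c t], multiplied by N Z^N Pi_N(x), is the
   differential relation between F and Z. *)
have [q Hq] : exists q, forall t, \sum_k b k * expR (dotp (ga k) t) = q * Z t ^+ N.
  apply: log_derivative_constant => // t; apply/rowP => i.
  pose x := moment_map P c t.
  have Px : P x := interior_subset (interior_moment t).
  have bE k : b k * expR (dotp (ga k) t) = Z t ^+ N * (mk k x / RNk k).
    rewrite /b mk_moment; field.
    by rewrite ZN_neq0 gt_eqF.
  have Pi0 : PiN P w N x != 0.
    have [k0 _] := RN_gt0_ex.
    rewrite PiNE (bigD1 k0)//= gt_eqF//; apply: ltr_pwDl.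
      rewrite divr_gt0// mk_moment divr_gt0 ?exprn_gt0//.
      by rewrite mulr_gt0 ?ck_gt0 ?expR_gt0.
    by rewrite sumr_ge0// => k _; rewrite divr_ge0 ?mk_ge0.
  have := congr1 (fun v : 'rV[R]_m => v ord0 i) (H x Px).
  rewrite /= barycenterE// {3}/x moment_mapE => xE.
  have sE : \sum_k b k * expR (dotp (ga k) t) = Z t ^+ N * PiN P w N x.
    by rewrite PiNE mulr_sumr; apply: eq_bigr => k _.
  rewrite summxE mxE -xE -mulr_suml sE mulr_sumr; apply: eq_bigr => k _.
  rewrite mxE bE; field.
  by rewrite NR Pi0 gt_eqF.
exact: exp_identity_constant Hq.
Qed.

Lemma RN_constant_iff_measures_agree :
  R_constant <-> bergman_defined P w N /\
    forall x, P x -> forall X : set 'rV[R]_m, measurable X ->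
      bergman_bernstein_measure P w N x X = dilated_bernstein_measure P w N x X.
Proof.
have NR : N%:R != 0 :> R by rewrite pnatr_eq0 -lt0n.
split => [Rc|[bd H]].
  split; first exact: constant_defined.
  have [q Rq] := Rc; move=> x Px X mX; rewrite dilatedE// nuE.
  by apply: eq_bigr => k _; rewrite (constant_coef _ Rq).
have [x Px] := P_interior; have Px' := interior_subset Px.
exists (PiN P w N x)^-1 => k.
have := H x Px' [set dilation N (ga k)] (measurable_set1_rV _).
rewrite dilatedE ?nuE//; last exact: measurable_set1_rV.
have atom (a : K -> R) :
    (\sum_i (a i)%:E * \d_(dilation N (ga i)) [set dilation N (ga k)])%E = (a k)%:E.
  rewrite (bigD1 k)//= diracE mem_set// mule1 big1 ?adde0// => i ik.
  rewrite diracE memNset ?mule0//= => /(scalerI _) E.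
  by move: ik; rewrite (ga_inj (E _)) ?eqxx ?invr_eq0.
rewrite !atom => -[E].
have mk0 : mk k x != 0.
  by rewrite mk_interior// gt_eqF// divr_gt0 ?exprn_gt0// mulr_gt0 ?ck_gt0 ?expR_gt0.
have Rk : RNk k != 0 by apply: bd; rewrite -gaE; exists k.
apply: invr_inj; rewrite invrK.
(* As 1/0 = 0, a vanishing Pi_N(x) would turn [E] into m^gamma(x) = 0. *)
have Pi0 : PiN P w N x != 0.
  by apply: contra_eq_neq E => ->; rewrite invr0 mul0r eq_sym.
apply: (mulfI mk0); rewrite -[X in _ = X * _]E.
by field; rewrite ?Pi0 ?Rk.
Qed.

End bergman_bernstein.

Theorem proposition4p2 (R : realType) (m : nat) (P : set 'rV[R]_m)
    (P_polytope : lattice_polytope P) (P_interior : P° !=set0)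
    (P_Delzant : Delzant P)
    (c : 'rV[R]_m -> R)
    (c_gt0 : forall alpha, lattice_points P alpha -> 0 < c alpha)
    (N : nat) (N_gt0 : (0 < N)%N)
    (w : 'rV[R]_m -> 'rV[R]_m -> R) (w_weights : bernstein_weights P c w) :
  let R_constant :=
    exists K : R, forall gamma, dilated_lattice_points P N gamma ->
      RN P w N gamma = K in
  let Pi_constant :=
    bergman_defined P w N /\
    exists K : R, forall x, P x -> PiN P w N x = K in
  let barycenter_condition :=
    bergman_defined P w N /\
    forall x, P x -> barycenter (bergman_bernstein_measure P w N x) = x in
  let measures_agree :=
    bergman_defined P w N /\
    forall x, P x -> forall X : set 'rV[R]_m, measurable X ->
      bergman_bernstein_measure P w N x X = dilated_bernstein_measure P w N x X
  in
  [/\ R_constant <-> Pi_constant,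
      R_constant <-> barycenter_condition
    & R_constant <-> measures_agree].

Proof.
move=> R_constant Pi_constant barycenter_condition measures_agree.
have [V [V_fin V_lattice PE]] := P_polytope.
have [B B0 PB] := convex_hull_bounded V_fin.
have S_fin : finite_set (lattice_points P).
  apply: (@sub_finite_set _ _ (box 0 B `&` lattice)).
    by move=> x [Px Lx]; split => //; apply: PB; rewrite -PE.
  exact: finite_lattice_box.
have SN_fin : finite_set (dilated_lattice_points P N).
  apply: (@sub_finite_set _ _ (box 0 (N%:R * B) `&` lattice)).
    move=> _ [[x Px <-] Lx]; split => // i; rewrite !mxE subr0 normrM normr_nat.
    rewrite ler_pM2l ?ltr0n//; have := PB x; rewrite -PE => /(_ Px i).
    by rewrite mxE subr0.
  exact: finite_lattice_box.
have [J [al [al_inj alE]]] := finite_set_enum S_fin.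
have [K [ga [ga_inj gaE]]] := finite_set_enum SN_fin.
have R_constantP : R_constant <-> exists q : R, forall k, RN P w N (ga k) = q.
  split=> -[q Rq]; exists q; first by move=> k; apply: Rq; rewrite -gaE; exists k.
  by move=> g; rewrite -gaE => -[k _ <-].
split; apply: (iff_trans R_constantP).
- exact: (RN_constant_iff_PiN_constant V_fin V_lattice PE P_interior c_gt0
    N_gt0 w_weights al_inj alE ga_inj gaE).
- exact: (RN_constant_iff_barycenter V_fin V_lattice PE P_interior c_gt0
    N_gt0 w_weights al_inj alE ga_inj gaE).
- exact: (RN_constant_iff_measures_agree V_fin V_lattice PE P_interior c_gt0
    N_gt0 w_weights al_inj alE ga_inj gaE).
Qed.
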